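(* Let $\beta>1$ and let $\lambda\in\mathbb{C}$ be a complex number with $1/\beta<|\lambda|\le1$. Define $F_\lambda:[0,1]\to\mathbb{C}$ by $F_\lambda(x)=\sum_{n=1}^\infty\frac{a_n(\beta,x)}{\beta^n\lambda^n}$. Then the following hold. (1) The function $F_\lambda$ is right-continuous on $[0,1)$. (2) The function $F_\lambda$ is left-continuous at any non-simple $x\in(0,1]$. (3) The function $F_\lambda$ is left-continuous at any simple $x\in(0,1]$ if and only if $\lambda$ is an isolated eigenvalue of $\mathcal{L}_\beta$. (4) If $\lambda$ is the leading eigenvalue $1$ of $\mathcal{L}_\beta$, then $F_\lambda(x)=x$ for all $x\in[0,1]$. In particular, $F_\lambda$ is differentiable on $[0,1]$. (5) If $\lambda$ is a non-leading eigenvalue of $\mathcal{L}_\beta$, then $F_\lambda$ is not Lipschitz continuous on $[0,1]$. In particular, it is nowhere differentiable on $[0,1]$.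
   Context: For real $\beta>1$, the beta-map is $\tau_\beta:[0,1]\to[0,1]$, $\tau_\beta(x)=\beta x-[\beta x]$, where $[y]$ is the integer part of $y\ge 0$; $\tau_\beta^0(x)=x$. For $x\in[0,1]$ and $n\ge1$ put $a_n(\beta,x)=[\beta\tau_\beta^{n-1}(x)]$. A number $x\in[0,1]$ is simple (with respect to $\beta$) if there is an integer $n_0\ge1$ with $\tau_\beta^{n_0-1}(x)\in\{1/\beta,\dots,[\beta]/\beta\}$, and non-simple otherwise. Let $BV$ be the Banach space of functions $f:[0,1]\to\mathbb{C}$ of bounded variation with norm $\|f\|_{BV}=\operatorname{var}(f)+\sup_{x\in[0,1]}|f(x)|$, let $\mathcal{N}\subset BV$ be the closed subspace of those $f\in BV$ that vanish outside some countable set, and let $\widehat{BV}=BV/\mathcal{N}$ with the quotient norm. The Perron-Frobenius operator $\mathcal{L}_\beta f(x)=\frac1\beta\sum_{y\in[0,1],\,\tau_\beta(y)=x}f(y)$ is considered as a bounded operator on $\widehat{BV}$. Every spectral value $\lambda$ of $\mathcal{L}_\beta$ with $|\lambda|>1/\beta$ is an isolated eigenvalue of finite multiplicity and satisfies $|\lambda|\le 1$; ''isolated eigenvalue'' means an eigenvalue with $|\lambda|>1/\beta$. The number $1$ is the leading eigenvalue; a non-leading eigenvalue is an isolated eigenvalue different from $1$ (it then satisfies $1/\beta<|\lambda|<1$). *)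

(* Defs.v *)
From HB Require Import structures.
From mathcomp Require Import all_boot all_order all_algebra.
From mathcomp Require Import all_classical all_reals all_analysis.
From mathcomp Require Import complex generic_quotient ring_quotient.
Set Implicit Arguments.
Unset Strict Implicit.
Unset Printing Implicit Defensive.
Import Order.TTheory GRing.Theory Num.Theory.
Import numFieldNormedType.Exports.
Import Normc.
Local Open Scope classical_set_scope.
Local Open Scope ring_scope.
Local Open Scope complex_scope.
Local Open Scope quotient_scope.

(* The complex numbers are R[i]^o rather than R[i]: this alias is the one that
   carries the topology induced by the modulus and the structure of a module
   over R[i].
   A function on [0, 1] is represented by a total function on R whose values
   outside [0, 1] are irrelevant: every notion below only looks at [0, 1], and
   functions that agree on [0, 1] have the same class in BVhat. *)

Section beta_expansion.
Variables (R : realType) (beta : R).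

Definition beta_map (x : R) : R := beta * x - (Num.truncn (beta * x))%:R.

(* The n-th digit a_n(beta, x), meaningful for n >= 1. *)
Definition digit (n : nat) (x : R) : nat :=
  Num.truncn (beta * iter n.-1 beta_map x).

Definition simple_number (x : R) : Prop :=
  exists2 n0 : nat, (1 <= n0)%N &
  exists2 k : nat, (1 <= k <= Num.truncn beta)%N &
    iter n0.-1 beta_map x = k%:R / beta.

Definition F (lambda : R[i]) (x : R) : R[i]^o :=
  lim ((\sum_(1 <= n < N)
          (digit n x)%:R / (beta%:C ^+ n * lambda ^+ n) : R[i]^o) @[N --> \oo]).

End beta_expansion.

Section regularity.
Variable R : realType.
Implicit Types (f : R -> R[i]^o) (x : R).

Definition right_continuous_at f x : Prop := f y @[y --> x^'+] --> f x.

Definition left_continuous_at f x : Prop := f y @[y --> x^'-] --> f x.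

(* Differentiability of the restriction of f to [0, 1]; the derivative is
   one-sided at the endpoints. *)
Definition differentiable_at01 f x : Prop :=
  exists l : R[i]^o,
    ((y - x)%:C^-1 * (f y - f x) : R[i]^o)
      @[y --> within [set y : R | 0 <= y <= 1] x^'] --> l.

Definition lipschitz01 f : Prop :=
  exists K : R, forall x y : R, 0 <= x <= 1 -> 0 <= y <= 1 ->
    `|f x - f y| <= (K * `|x - y|)%:C.

End regularity.

(* Complex-valued analogues of the library's variation and bounded_variation,
   which are restricted to real-valued functions. *)
Section complex_variation.
Variable R : realType.
Implicit Types (f g : R -> R[i]^o) (a b : R) (s : seq R).

Definition cvariation a b f s : R :=
  let f' := f \o nth b (a :: s) in
  \sum_(0 <= n < size s) normc (f' n.+1 - f' n).

Definition bounded_cvariation a b f : Prop :=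
  has_ubound [set cvariation a b f s | s in itv_partition a b].

Lemma bounded_cvariationP a b f : bounded_cvariation a b f <->
  exists M : R, forall s, itv_partition a b s -> cvariation a b f s <= M.
Proof.
split=> -[M hM]; exists M.
  by move=> s hs; apply: hM; exists s.
by move=> _ [s hs <-]; exact: hM.
Qed.

Lemma normc_ge0 (z : R[i]) : 0 <= normc z.
Proof. by case: z => u v; rewrite /normc sqrtr_ge0. Qed.

Lemma cvariation_nil a b f : cvariation a b f [::] = 0.
Proof. by rewrite /cvariation big_nil. Qed.

Lemma cvariation_cons a b f x s :
  cvariation a b f (x :: s) = normc (f x - f a) + cvariation x b f s.
Proof. by rewrite /cvariation /= big_nat_recl//= big_nat. Qed.

Lemma cvariation_ge0 a b f s : 0 <= cvariation a b f s.
Proof. by apply: sumr_ge0 => i _; exact: normc_ge0. Qed.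

Lemma cvariation_cat a b f s t :
  cvariation a b f (s ++ t) = cvariation a b f s + cvariation (last a s) b f t.
Proof.
elim: s a => [|x s IH] a /=; first by rewrite cvariation_nil add0r.
by rewrite !cvariation_cons IH addrA.
Qed.

Lemma cvariation_lin a b (k : R[i]) f g s :
  cvariation a b (k *: f + g) s <=
  normc k * cvariation a b f s + cvariation a b g s.
Proof.
rewrite /cvariation mulr_sumr -big_split/=; apply: ler_sum => i _.
rewrite -normcM; apply: le_trans (le_normcD _ _).
rewrite le_eqVlt; apply/orP; left; apply/eqP; congr normc.
by rewrite !fctE /GRing.scale/= mulrBr opprD addrACA.
Qed.

Lemma bounded_cvariation_lin a b (k : R[i]) f g :
  bounded_cvariation a b f -> bounded_cvariation a b g ->
  bounded_cvariation a b (k *: f + g).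
Proof.
move=> /bounded_cvariationP[M hM] /bounded_cvariationP[N hN].
apply/bounded_cvariationP; exists (normc k * M + N) => s hs.
apply: le_trans (cvariation_lin _ _ _ _ _ _) _.
by apply: lerD (hN _ hs); apply: ler_wpM2l (hM _ hs); exact: normc_ge0.
Qed.

Lemma cvariation0 a b s : cvariation a b 0 s = 0.
Proof.
by rewrite /cvariation big1// => i _; rewrite !fctE subrr; exact: normc0.
Qed.

End complex_variation.

Section BV_space.
Variable R : realType.

Definition BV_pred : {pred (R -> R[i]^o)} :=
  fun f => `[< bounded_cvariation 0 1 f >].

Lemma BV_pred_submod : submod_closed BV_pred.
Proof.
split=> [|k f g /asboolP hf /asboolP hg]; apply/asboolP.
  by exists 0 => _ [s _ <-]; rewrite cvariation0.
exact: bounded_cvariation_lin.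
Qed.

HB.instance Definition _ :=
  GRing.isSubmodClosed.Build _ _ BV_pred BV_pred_submod.

Record BV := MkBV { BV_fun :> R -> R[i]^o ; _ : BV_fun \in BV_pred }.

HB.instance Definition _ := [isSub for BV_fun].
HB.instance Definition _ := [Choice of BV by <:].
HB.instance Definition _ := [SubChoice_isSubLmodule of BV by <:].

Definition BV_null : {pred BV} :=
  fun f => `[< exists2 A : set R, countable A &
                 forall x : R, 0 <= x <= 1 -> ~ A x -> f x = 0 >].

Lemma BV_null_submod : submod_closed BV_null.
Proof.
split=> [|k f g /asboolP[A cA hf] /asboolP[B cB hg]]; apply/asboolP.
  by exists set0.
exists (\bigcup_(b in [set: bool]) if b then A else B).
  by apply: bigcup_countable => [|[]].
move=> x x01 nAB.
have nA : ~ A x by move=> Ax; apply: nAB; exists true.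
have nB : ~ B x by move=> Bx; apply: nAB; exists false.
rewrite [LHS](_ : _ = k * f x + g x)//.
by rewrite hf// hg// mulr0 addr0.
Qed.

HB.instance Definition _ :=
  GRing.isSubmodClosed.Build _ _ BV_null BV_null_submod.

Definition BVhat := Quotient.quot (BV_null : zmodClosed BV).

HB.instance Definition _ := GRing.Zmodule.on BVhat.

Definition BV_class (f : BV) : BVhat := \pi_BVhat f.

Definition BV_repr (u : BVhat) : BV := repr u.

Lemma BV_reprK : cancel BV_repr BV_class.
Proof. exact: reprK. Qed.

Lemma BV_class_eqP (f g : BV) :
  reflect (BV_class f = BV_class g) (f - g \in BV_null).
Proof. by rewrite Quotient.idealrBE; exact: eqP. Qed.

Lemma BV_class0 : BV_class (0 : BV) = 0.
Proof. exact: (@pi_zeror _ _ _ _ _ (Quotient.quot (BV_null : zmodClosed BV))). Qed.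

Lemma BV_classD (f g : BV) :
  BV_class (f + g) = BV_class f + BV_class g.
Proof. exact: Quotient.pi_add. Qed.

Definition BVhat_scale (k : R[i]) (u : BVhat) : BVhat :=
  BV_class (k *: BV_repr u).

Lemma BV_scale_class k (f : BV) :
  BVhat_scale k (BV_class f) = BV_class (k *: f).
Proof.
apply/BV_class_eqP; rewrite -scalerBr rpredZ//.
by apply/BV_class_eqP; rewrite BV_reprK.
Qed.

Lemma BVhat_ind (P : BVhat -> Prop) :
  (forall f : BV, P (BV_class f)) -> forall u, P u.
Proof. by move=> h u; rewrite -[u]BV_reprK. Qed.

Lemma BVhat_scaleA a b (u : BVhat) :
  BVhat_scale a (BVhat_scale b u) = BVhat_scale (a * b) u.
Proof. by elim/BVhat_ind: u => f; rewrite !BV_scale_class scalerA. Qed.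

Lemma BVhat_scale1 : left_id 1 BVhat_scale.
Proof. by elim/BVhat_ind => f; rewrite BV_scale_class scale1r. Qed.

Lemma BVhat_scaleDr : right_distributive BVhat_scale +%R.
Proof.
move=> a; elim/BVhat_ind => f; elim/BVhat_ind => g.
by rewrite -BV_classD !BV_scale_class -BV_classD scalerDr.
Qed.

Lemma BVhat_scaleDl (u : BVhat) : {morph BVhat_scale^~ u : a b / a + b}.
Proof.
elim/BVhat_ind: u => f a b.
by rewrite !BV_scale_class -BV_classD scalerDl.
Qed.

HB.instance Definition _ := GRing.Zmodule_isLmodule.Build R[i] BVhat
  BVhat_scaleA BVhat_scale1 BVhat_scaleDr BVhat_scaleDl.

Lemma BV_classZ (k : R[i]) (f : BV) :
  BV_class (k *: f) = k *: BV_class f.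
Proof. by rewrite -BV_scale_class. Qed.

End BV_space.

Section perron_frobenius.
Variables (R : realType) (beta : R).
Implicit Types (f g : R -> R[i]^o).

Definition fiber (x : R) : set R :=
  [set y | 0 <= y <= 1 /\ beta_map beta y = x].

(* The fibers over [0, 1] are finite (fiber_finite below), so that the sum is
   not affected by the convention that a sum with infinite support is 0. *)
Definition transfer f (x : R) : R[i]^o :=
  (beta^-1)%:C * \sum_(y \in fiber x) f y.

Hypothesis beta_gt1 : 1 < beta.

Let beta_gt0 : 0 < beta. Proof. exact: lt_trans beta_gt1. Qed.

Let beta_neq0 : beta != 0. Proof. by rewrite gt_eqF. Qed.

(* The k-th inverse branch y = (x + k) / beta of beta_map is defined at x; there
   is none at x = 1, since beta_map takes its values in [0, 1[. *)
Definition branch (x : R) (k : nat) : bool := (x < 1) && (x + k%:R <= beta).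

Lemma fiberE (x : R) : 0 <= x <= 1 ->
  fiber x = [set (x + k%:R) / beta | k in
    [set` [seq k <- iota 0 (Num.truncn beta).+1 | branch x k]]].
Proof.
move=> /andP[x0 x1]; apply/seteqP; split=> [y [/andP[y0 y1] yx]|_ [k + <-]].
  have by0 : 0 <= beta * y by rewrite mulr_ge0// ltW.
  have /andP[lo hi] := Num.Theory.truncn_itv by0.
  exists (Num.truncn (beta * y)); last first.
    by rewrite -yx /beta_map subrK mulrC mulKf.
  rewrite /mkset mem_filter mem_iota add0n ltnS leq0n andTb; apply/andP; split.
    rewrite /branch -yx /beta_map subrK ltrBlDl -natr1 in hi *.
    by rewrite hi/= ler_piMr// ltW.
  by apply: Num.Theory.le_truncn; rewrite ler_piMr// ltW.
rewrite /mkset mem_filter => /andP[/andP[xlt xk] _].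
split; first by rewrite divr_ge0 ?addr_ge0 ?(ltW beta_gt0)//= ler_pdivrMr// mul1r.
rewrite /beta_map mulrC divfK//.
rewrite (_ : Num.truncn _ = k) ?addrK//.
apply/eqP; rewrite Num.Theory.truncn_eq ?addr_ge0// lerDr x0/=.
by rewrite -natr1 addrC ltrD2l.
Qed.

Lemma fiber_finite (x : R) : 0 <= x <= 1 -> finite_set (fiber x).
Proof. by move=> x01; rewrite fiberE//; apply: finite_image. Qed.

Lemma transferE f (x : R) : 0 <= x <= 1 ->
  transfer f x = (beta^-1)%:C * \sum_(0 <= k < (Num.truncn beta).+1)
     (if branch x k then f ((x + k%:R) / beta) else 0).
Proof.
move=> x01; congr (_ * _).
rewrite fiberE// fsbig_image; last first.
  by move=> k l _ _ /(mulIf (invr_neq0 beta_neq0))/addrI/(mulrIn _) ->.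
rewrite -fsbig_seq ?filter_uniq ?iota_uniq// big_filter -big_mkcond.
by rewrite /index_iota subn0.
Qed.


Lemma cvariation_chain f : bounded_cvariation 0 1 f ->
  exists M : R, forall (a : R) (s : seq R), 0 <= a -> path <%R a s -> last a s <= 1 ->
    cvariation a 1 f s <= M.
Proof.
move=> /bounded_cvariationP[M hM]; exists M => a s a0 pas las.
pose t : seq R := if last a s < 1 then [:: 1] else [::].
have ast : itv_partition a 1 (s ++ t).
  rewrite /itv_partition cat_path last_cat pas /t.
  by case: (ltgtP (last a s) 1) las => //= -> _; split.
apply: (@le_trans _ _ (cvariation a 1 f (s ++ t))).
  by rewrite cvariation_cat lerDl cvariation_ge0.
case: ast => ast lst; move: a0; rewrite le_eqVlt => /predU1P[a0|a0].
  by subst a; apply: hM; split.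
apply: le_trans (hM (a :: (s ++ t)) _); last by split => //=; rewrite a0.
by rewrite cvariation_cons lerDr normc_ge0.
Qed.

Lemma transfer_bounded_cvariation f :
  bounded_cvariation 0 1 f -> bounded_cvariation 0 1 (transfer f).
Proof.
move=> bf.
pose g k (x : R) : R[i]^o := if branch x k then f ((x + k%:R) / beta) else 0.
have gE x : 0 <= x <= 1 -> transfer f x =
    (beta^-1)%:C * \sum_(0 <= k < (Num.truncn beta).+1) g k x.
  exact: transferE.
have bg k : bounded_cvariation 0 1 (g k).
  have [M hM] := cvariation_chain bf.
  have fB y : 0 <= y <= 1 -> normc (f y) <= normc (f 0) + M.
    move=> /andP[]; rewrite le_eqVlt => /predU1P[<- _|y0 y1].
      rewrite lerDl; apply: le_trans (hM 0 [::] _ _ _) => //=.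
      by rewrite cvariation_nil.
    have := hM 0 [:: y]; rewrite /= y0 lexx y1 => /(_ isT isT isT).
    rewrite cvariation_cons cvariation_nil addr0 => h.
    rewrite -[f y](subrK (f 0)) addrC.
    by apply: le_trans (le_normcD _ _) _; rewrite lerD2l.
  pose phi (x : R) := (x + k%:R) / beta.
  have phi01 x : 0 <= x -> branch x k -> 0 <= phi x <= 1.
    move=> x0 /andP[_ xk]; apply/andP; split.
      by rewrite divr_ge0 ?addr_ge0 ?(ltW beta_gt0).
    by rewrite ler_pdivrMr// mul1r.
  have gz : forall (s : seq R) (x : R), ~~ branch x k -> path <%R x s ->
      cvariation x 1 (g k) s = 0.
    elim=> [|y s IH] x xk /=; first by rewrite cvariation_nil.
    move=> /andP[xy ys]; have yk : ~~ branch y k.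
      apply: contra xk => /andP[y1 yk]; rewrite /branch (lt_trans xy)//=.
      by apply: le_trans yk; rewrite lerD2r ltW.
    rewrite cvariation_cons IH// addr0 /g (negbTE xk) (negbTE yk) subrr.
    exact: normc0.
  have B0 : 0 <= normc (f 0) + M.
    by apply: le_trans (fB 0 _); rewrite ?normc_ge0// lexx ler01.
  have key (s : seq R) : forall a : R, 0 <= a -> branch a k -> path <%R a s ->
      exists t, [/\ path <%R (phi a) t, last (phi a) t <= 1 &
        cvariation a 1 (g k) s <=
          cvariation (phi a) 1 f t + (normc (f 0) + M)].
    elim: s => [|x s IH] a a0 ak /=.
      move=> _; exists [::]; split=> //=; first by case/andP: (phi01 _ a0 ak).
      by rewrite !cvariation_nil add0r.
    move=> /andP[ax xs]; have x0 : 0 <= x by exact: le_trans (ltW ax).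
    rewrite cvariation_cons {1 2}/g ak; case: ifPn => xk.
      have [t [t1 t2 t3]] := IH x x0 xk xs.
      exists (phi x :: t); split=> //=.
        by rewrite t1 andbT ltr_pM2r ?invr_gt0// ltrD2r.
      by rewrite cvariation_cons -addrA lerD2l.
    exists [::]; split=> //=; first by case/andP: (phi01 _ a0 ak).
    rewrite cvariation_nil !add0r gz// addr0 (@normcN R (f _)).
    exact: fB (phi01 _ a0 ak).
  apply/bounded_cvariationP; exists (M + (normc (f 0) + M)) => s.
  move=> [p0 _]; have M0 : 0 <= M.
    by have := hM 0 [::]; rewrite cvariation_nil => /(_ (lexx _) isT ler01).
  have [k0|k0] := boolP (branch 0 k); last by rewrite gz// addr_ge0.
  have [t [t1 t2 t3]] := key _ 0 (lexx _) k0 p0.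
  apply: le_trans t3 _; rewrite lerD2r; apply: hM => //.
  by case/andP: (phi01 0 (lexx _) k0).
have bsum n : bounded_cvariation 0 1 (\sum_(0 <= k < n) g k).
  elim: n => [|n IH].
    by rewrite big_nil; exists 0 => _ [s _ <-]; rewrite cvariation0.
  by rewrite big_nat_recr//= -[X in X + _]scale1r; exact: bounded_cvariation_lin.
have /bounded_cvariationP[M hM] : bounded_cvariation 0 1
    ((beta^-1)%:C *: (\sum_(0 <= k < (Num.truncn beta).+1) g k) + 0).
  apply: bounded_cvariation_lin => //.
  by exists 0 => _ [s _ <-]; rewrite cvariation0.
apply/bounded_cvariationP; exists M => s hs; apply: le_trans (hM s hs).
rewrite le_eqVlt; apply/orP; left; apply/eqP.
apply: eq_big_nat => n /andP[_ ns] /=.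
have h m : (m < (size s).+1)%N ->
    transfer f (nth 1 (0 :: s) m) =
    ((beta^-1)%:C *: (\sum_(0 <= k < (Num.truncn beta).+1) g k) + 0)
      (nth 1 (0 :: s) m).
  move=> ms; rewrite gE; last first.
    by rewrite (itv_partition_nth_ge _ hs)// (itv_partition_nth_le _ hs).
  by rewrite addr0 [RHS]/GRing.scale/= fct_sumE.
by rewrite (h n.+1)// (h n)// ltnS ltnW.
Qed.

Lemma transfer_linear k f g (x : R) : 0 <= x <= 1 ->
  transfer (k *: f + g) x = k * transfer f x + transfer g x.
Proof.
move=> x01; rewrite !transferE// mulrCA -mulrDr; congr (_ * _).
rewrite mulr_sumr -big_split/=; apply: eq_bigr => j _.
by case: ifP => // _; rewrite mulr0 addr0.
Qed.

Lemma transfer_null f (A : set R) :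
  (forall x : R, 0 <= x <= 1 -> ~ A x -> f x = 0) ->
  forall x : R, 0 <= x <= 1 -> ~ (beta_map beta @` A) x ->
    transfer f x = 0.
Proof.
move=> fA x x01 nAx; rewrite /transfer fsbig1 ?mulr0// => y [y01 yx].
by apply: fA => // Ay; apply: nAx; exists y.
Qed.

Lemma transfer_BV_subproof (f : BV R) : transfer f \in @BV_pred R.
Proof.
by case: f => f /= /asboolP bf; apply/asboolP; exact: transfer_bounded_cvariation.
Qed.

Definition transfer_BV (f : BV R) : BV R := MkBV (transfer_BV_subproof f).

(* Defined on representatives; see transfer_BV_class for the independence from
   the choice of the representative. *)
Definition transfer_BVhat (u : BVhat R) : BVhat R :=
  BV_class (transfer_BV (BV_repr u)).

Lemma transfer_BV_class (f : BV R) :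
  transfer_BVhat (BV_class f) = BV_class (transfer_BV f).
Proof.
apply/BV_class_eqP.
have /BV_class_eqP/asboolP[A cA hA] : BV_class (BV_repr (BV_class f)) = BV_class f.
  exact: BV_reprK.
apply/asboolP; exists (beta_map beta @` A).
  exact: sub_countable (card_image_le _ _) cA.
move=> x x01 nAx.
rewrite [LHS](_ : _ = transfer (-1 *: (f : R -> R[i]^o) + BV_repr (BV_class f)) x).
  apply: (transfer_null _ x01 nAx) => y y01 /(hA y y01) <-.
  by rewrite scaleN1r addrC.
by rewrite transfer_linear// mulN1r addrC.
Qed.

Lemma transfer_BVhat_linear : linear transfer_BVhat.
Proof.
move=> k; elim/BVhat_ind => f; elim/BVhat_ind => g.
rewrite -BV_classZ -BV_classD !transfer_BV_class -BV_classZ -BV_classD.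
apply/BV_class_eqP/asboolP; exists set0 => // x x01 _.
rewrite [LHS](_ : _ = transfer (k *: (f : R -> R[i]^o) + g) x
  - (k * transfer f x + transfer g x))//.
by rewrite transfer_linear// subrr.
Qed.

(* Being an eigenvalue is a purely algebraic notion, so the norm of BVhat plays
   no role here. *)
Definition isolated_eigenvalue (lambda : R[i]) : Prop :=
  (beta^-1)%:C < `|lambda| /\
  exists2 u : BVhat R, u != 0 & transfer_BVhat u = lambda *: u.

Definition nonleading_eigenvalue (lambda : R[i]) : Prop :=
  isolated_eigenvalue lambda /\ lambda != 1.

End perron_frobenius.

(* Main.v *)
Require Import Defs.
From mathcomp Require Import all_boot all_order all_algebra.
From mathcomp Require Import all_classical all_reals all_analysis.
From mathcomp Require Import complex.
From mathcomp Require Import ring lra.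
Set Implicit Arguments.
Unset Strict Implicit.
Unset Printing Implicit Defensive.
Import Order.TTheory GRing.Theory Num.Theory.
Import numFieldNormedType.Exports.
Import Normc.
Local Open Scope classical_set_scope.
Local Open Scope ring_scope.
Local Open Scope complex_scope.

(** Write [T] for the beta-map, [d x] for the first digit of [x] and
    [z = 1 / (beta * lambda)], so that [|z| < 1].  Everything rests on the
    functional equation [F x = z * (d x + F (T x))] (lemma [F_rec]), used
    together with the remark that a bounded function [u] with
    [u x = z * u (T x)] along the orbits of [T] has to vanish
    ([contraction_eq0], and [contraction_le0] for inequalities).

    Regularity.  To the right of [x < 1] a short interval has the same first
    [n] digits as [x], so there [F y - F x = z ^ n * (F (T^n y) - F (T^n x))],
    which is small.  To the left of [x > 0] the first [n] digits are those of
    the left-continuous version [T'] of the beta-map, the one whose values lie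
    in the half-open interval from 0 (excluded) to 1 (included).  Hence the left
    limit of [F] at [x] is the sum [F_left x] of the digit series of [T'].  The
    two digit sequences agree when [x] is non-simple.  When [x] is simple they
    part at the first integer value of [beta * T^(j-1) x], after which [T] stays
    at 0 whereas [T'] restarts at 1; this gives
    [F x - F_left x = z ^ j * (1 - F_left 1)].  So left continuity at one simple
    number amounts to [F_left 1 = 1], and this to [F 1 = 1] ([F_left1]).

    Eigenvalues.  It remains to see that [lambda] is an eigenvalue exactly when
    [F 1 = 1].  The function [h = sum_n z ^ n * 1_[0, T^n 1)] satisfies
    [L h = lambda * (h + F 1 - 1)] on [[0, 1)] ([transfer_parry1]), it has
    bounded variation and it tends to 1 at 1; if [F 1 = 1] it is an
    eigenfunction.  Conversely let [f] be an eigenfunction, let [c] be a limit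
    value of [f] at 1, and put [g = f - c * h].  Then [L g] equals [lambda * g]
    up to a constant, and [g] vanishes at 1.  The branches of [L g] therefore
    join into one increasing sweep through the interval with no jump at its end,
    so that the variation of [L g] is at most [1 / beta] times that of [g].
    Since [1 / beta < |lambda|], the variation of [g] is 0 and [g = 0]
    ([branch_contraction]).  Thus [f = c * h] with [c] nonzero, and the
    eigenvalue equation for [h] gives [F 1 = 1].

    Differentiability.  For [lambda = 1], both [F x] and [x] solve the same
    functional equation.  An eigenvalue with [|lambda| = 1] equals 1 by the case
    of equality in the triangle inequality ([unimodular_eq1]), so a non-leading
    eigenvalue has [|lambda| < 1].  The increment of [F] between the left end
    [u] of a cylinder of order [n] and [w = u + beta ^ -(n + m)] is
    [z ^ (n + m)], so its difference quotient is [lambda ^ -(n + m)], which is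
    unbounded.  Such pairs exist at arbitrarily small scale around every point,
    at a distance comparable to [w - u] ([steep_pair]), which excludes both a
    Lipschitz bound and a derivative. *)

(** * Complex moduli, contractions and sums along an orbit *)

Section complex_modulus.
Variable R : realType.
Implicit Types (z w : R[i]) (e : R).

Lemma normr_normc z : `|z| = (normc z)%:C.
Proof. by []. Qed.

Lemma normc_real (x : R) : normc x%:C = `|x|.
Proof. by rewrite /normc/= expr0n/= addr0 sqrtr_sqr. Qed.

Lemma normcX z n : normc (z ^+ n) = normc z ^+ n.
Proof. by elim: n => [|n IH]; rewrite ?expr0 ?normc1// !exprS normcM IH. Qed.

Lemma normc_natr n : normc (n%:R : R[i]) = n%:R.
Proof.
by rewrite -[n%:R](rmorph_nat (real_complex R)) normc_real normr_nat.
Qed.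

Lemma normc_eq0 z : (normc z == 0) = (z == 0).
Proof. by apply/eqP/eqP => [/eq0_normc|->]//; exact: normc0. Qed.

Lemma normc_gt0 z : (0 < normc z) = (z != 0).
Proof. by rewrite lt_def normc_eq0 normc_ge0 andbT. Qed.

Lemma normcB z w : normc (z - w) = normc (w - z).
Proof. by rewrite -opprB normcN. Qed.

Lemma normc_le_sum z : normc z <= `|complex.Re z| + `|complex.Im z|.
Proof.
rewrite {1}[z]complexE; apply: le_trans (le_normcD _ _) _.
rewrite normcM !normc_real (_ : normc 'i%C = 1) ?mul1r//.
by rewrite /normc/= expr0n expr1n add0r sqrtr1.
Qed.

Lemma Re_le_normc z : `|complex.Re z| <= normc z.
Proof. by rewrite -lecR; exact: normc_ge_Re. Qed.

Lemma Im_le_normc z : `|complex.Im z| <= normc z.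
Proof.
case: z => a b /=; rewrite -sqrtr_sqr ler_sqrt ?lerDr ?sqr_ge0//.
by rewrite addr_ge0 ?sqr_ge0.
Qed.

(** The topology of [R[i]^o] is stated with complex radii; real radii and the
    real-valued modulus suffice. *)
Lemma cvg_normcP (T : Type) (G : set_system T) (FG : Filter G)
    (f : T -> R[i]^o) (l : R[i]^o) :
  f @ G --> l <-> forall e, 0 < e -> \forall t \near G, normc (l - f t) < e.
Proof.
split=> [/cvgrPdist_lt h e e0|h].
  have := h e%:C; rewrite ltcR => /(_ e0).
  by apply: filterS => t; rewrite normr_normc ltcR.
apply/cvgrPdist_lt => e; rewrite ltcE/= => /andP[/eqP ie re].
have -> : e = (complex.Re e)%:C by rewrite [LHS]complexE ie mulr0 addr0.
by have := h _ re; apply: filterS => t; rewrite normr_normc ltcR.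
Qed.

Lemma cvg_complex (u : nat -> R[i]) (a b : R) :
  (@complex.Re R \o u) @ \oo --> a -> (@complex.Im R \o u) @ \oo --> b ->
  (u : nat -> R[i]^o) @ \oo --> ((a +i* b)%C : R[i]^o).
Proof.
move=> /cvgrPdist_lt ha /cvgrPdist_lt hb; apply/cvg_normcP => e e0.
have e20 : 0 < e / 2 by rewrite divr_gt0.
have := ha _ e20; have := hb _ e20; apply: filterS2 => n /= h1 h2.
apply: le_lt_trans (normc_le_sum _) _.
rewrite [e in X in _ < X]splitr -/(e / 2) addrC.
by move: (u n) h1 h2 => [c d] /=; exact: ltrD.
Qed.

End complex_modulus.

Section contraction.
Variable R : realType.

Lemma expr_small (r K e : R) : 0 <= r < 1 -> 0 < e ->
  exists n, r ^+ n * K < e.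
Proof.
move=> /andP[r0 r1] e0.
have : `|r| < 1 by rewrite ger0_norm.
move/cvg_expr => /cvgrPdist_lt /(_ (e / (`|K| + 1))).
rewrite divr_gt0 ?ltr_pwDr// => /(_ isT) [n _ /(_ n (leqnn n))] /=.
rewrite sub0r normrN ger0_norm ?exprn_ge0// => h; exists n.
move: h; rewrite ltr_pdivlMr ?ltr_pwDr//; apply: le_lt_trans.
rewrite ler_wpM2l ?exprn_ge0//.
by rewrite (le_trans (ler_norm _))// lerDl.
Qed.

(** Iterating the inequality [n] times bounds [u x] by [r ^ n * K]. *)
Lemma contraction_le0 (X : Type) (P : X -> Prop) (T : X -> X) (u : X -> R)
    (r K : R) : 0 <= r < 1 -> (forall x, P x -> P (T x)) ->
  (forall x, P x -> u x <= r * u (T x)) -> (forall x, P x -> u x <= K) ->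
  forall x, P x -> u x <= 0.
Proof.
move=> r01 PT uT uK x Px; apply/ler_addgt0Pr => e e0; rewrite add0r.
have [n hn] := expr_small K r01 e0.
apply: le_trans (ltW hn); case/andP: r01 => r0 _ {hn}.
elim: n x Px => [|n IH] x Px; first by rewrite expr0 mul1r uK.
apply: le_trans (uT _ Px) _; rewrite exprS -mulrA ler_wpM2l//.
exact: IH (PT _ Px).
Qed.

Lemma contraction_eq0 (X : Type) (P : X -> Prop) (T : X -> X) (u : X -> R[i])
    (z : R[i]) (K : R) : normc z < 1 -> (forall x, P x -> P (T x)) ->
  (forall x, P x -> u x = z * u (T x)) -> (forall x, P x -> normc (u x) <= K) ->
  forall x, P x -> u x = 0.
Proof.
move=> z1 PT uT uK x Px; apply/eq0_normc/le_anti; rewrite normc_ge0 andbT.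
apply: (@contraction_le0 X P T (fun x => normc (u x)) (normc z) K) => //.
  by rewrite normc_ge0.
by move=> y Py; rewrite {1}uT// normcM.
Qed.

End contraction.

Section orbit_sum.
Variables (R : realType) (X : Type) (T : X -> X) (phi : X -> R[i]) (z : R[i]).

(** Three families of series are of this form: the digit series of [F], its
    left-continuous counterpart and the eigenfunctions of the transfer
    operator.  Beyond convergence only the recursion [orbit_sumE] and the bound
    [orbit_sum_bound] are ever used about them. *)
Definition orbit_sum (x : X) : R[i]^o :=
  lim ((\sum_(0 <= n < N) z ^+ n * phi (iter n T x) : R[i]^o) @[N --> \oo]).

Hypothesis z1 : normc z < 1.
Variables (P : X -> Prop) (B : R).
Hypothesis PT : forall x, P x -> P (T x).
Hypothesis phiB : forall x, P x -> normc (phi x) <= B.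

Let Piter n x : P x -> P (iter n T x).
Proof. by move=> Px; elim: n => //= n; exact: PT. Qed.

Lemma orbit_sum_cvg x : P x ->
  (\sum_(0 <= n < N) z ^+ n * phi (iter n T x) : R[i]^o) @[N --> \oo]
    --> orbit_sum x.
Proof.
move=> Px; set u := fun N : nat => _.
pose t n := z ^+ n * phi (iter n T x).
have tB n : normc (t n) <= B * normc z ^+ n.
  rewrite normcM normcX mulrC ler_wpM2r ?exprn_ge0 ?normc_ge0//.
  by rewrite phiB//; exact: Piter.
have z01 : `|normc z| < 1 by rewrite ger0_norm// normc_ge0.
(* Completeness is available for the reals: the real and imaginary parts are
   dominated by a geometric series. *)
have part (p : R[i] -> R) : (forall a b, p (a + b) = p a + p b) -> p 0 = 0 ->
    (forall a, `|p a| <= normc a) -> cvgn (p \o u).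
  move=> pD p0 ple.
  have -> : p \o u = series (p \o t).
    apply/funext; rewrite /u seriesEnat; elim=> [|N IH] /=.
      by rewrite !big_nil.
    by rewrite !big_nat_recr//= pD; congr (_ + _); exact: IH.
  apply: normed_cvg; apply: (@series_le_cvg _ _ (geometric B (normc z))) => //.
  - by move=> n; exact: normr_ge0.
  - move=> n; rewrite /geometric/=; apply: mulr_ge0; last first.
      by rewrite exprn_ge0// normc_ge0.
    exact: le_trans (normc_ge0 _) (phiB Px).
  - by move=> n /=; apply: le_trans (ple _) (tB n).
  - exact: is_cvg_geometric_series.
have hR : cvgn (@complex.Re R \o u).
  by apply: part => // [[a b] [c d]|a]//; exact: Re_le_normc.
have hI : cvgn (@complex.Im R \o u).
  by apply: part => // [[a b] [c d]|a]//; exact: Im_le_normc.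
have := cvg_complex hR hI.
by move=> h; apply: cvgP h.
Qed.

Lemma orbit_sumE x : P x -> orbit_sum x = phi x + z * orbit_sum (T x).
Proof.
move=> Px; apply: (cvg_lim (@norm_hausdorff _ R[i]^o)).
rewrite -cvg_shiftS.
rewrite (_ : (fun n => _) =
    (fun N => phi x + z * \sum_(0 <= n < N) z ^+ n * phi (iter n T (T x)))).
  by apply: cvgD; [exact: cvg_cst|apply: cvgMr; exact: (orbit_sum_cvg (PT Px))].
apply/funext => N; rewrite big_nat_recl//= expr0 mul1r; congr (_ + _).
by rewrite mulr_sumr; apply: eq_bigr => i _; rewrite exprS -mulrA -iterSr.
Qed.

Lemma orbit_sum_bound x : P x -> normc (orbit_sum x) <= B / (1 - normc z).
Proof.
move=> Px; apply/ler_addgt0Pr => e e0.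
have B0 : 0 <= B := le_trans (normc_ge0 _) (phiB Px).
have z1' : 0 < 1 - normc z by rewrite subr_gt0.
have /cvg_normcP/(_ _ e0)[N _ /(_ N (leqnn N))/=] := orbit_sum_cvg Px.
set s := \sum_(_ <= _ < _) _ => h.
rewrite -[orbit_sum x](subrK s) addrC; apply: le_trans (le_normcD _ _) _.
apply: lerD (ltW h); rewrite {h}/s; elim: N x Px => [|N IH] x Px.
  by rewrite big_nil normc0 divr_ge0// ltW.
rewrite big_nat_recl//= expr0 mul1r.
under eq_bigr do rewrite exprS -mulrA -iterS iterSr.
rewrite -mulr_sumr; apply: le_trans (le_normcD _ _) _.
rewrite normcM.
apply: le_trans (lerD (phiB Px) (ler_wpM2l (normc_ge0 _) (IH _ (PT Px)))) _.
rewrite ler_pdivlMr// le_eqVlt; apply/orP; left; apply/eqP.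
by field; rewrite gt_eqF.
Qed.
End orbit_sum.

(** * The beta-map and its left-continuous version *)

Section beta_map.
Variables (R : realType) (beta : R).
Hypothesis beta_gt1 : 1 < beta.
Implicit Types x y : R.

Notation T := (beta_map beta).
Notation dgt x := (Num.truncn (beta * x)).

Let beta_gt0 : 0 < beta. Proof. exact: lt_trans beta_gt1. Qed.

Lemma beta_mapE x : T x = beta * x - (dgt x)%:R. Proof. by []. Qed.

Lemma beta_map_itv x : 0 <= x -> 0 <= T x < 1.
Proof.
move=> x0; have bx0 : 0 <= beta * x by rewrite mulr_ge0// ltW.
have /andP[lo hi] := Num.Theory.truncn_itv bx0.
by rewrite subr_ge0 lo ltrBlDr addrC natr1 hi.
Qed.

Lemma beta_map01 x : 0 <= x <= 1 -> 0 <= T x <= 1.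
Proof. by move=> /andP[x0 _]; have /andP[-> /ltW ->] := beta_map_itv x0. Qed.

Lemma iter_beta_map01 n x : 0 <= x <= 1 -> 0 <= iter n T x <= 1.
Proof. by move=> x01; elim: n => //= n; exact: beta_map01. Qed.

Lemma digit_le x : x <= 1 -> (dgt x <= Num.truncn beta)%N.
Proof. by move=> x1; apply: Num.Theory.le_truncn; rewrite ler_piMr// ltW. Qed.

Lemma digit_uniq x k : k%:R <= beta * x < k%:R + 1 -> dgt x = k.
Proof. by rewrite natr1 => ?; apply: Num.Theory.truncn_def. Qed.

Lemma beta_map0 : T 0 = 0.
Proof. by rewrite /beta_map mulr0 Num.Theory.truncn0 subrr. Qed.

(** The left limit of the digit function: the largest integer strictly below
    [beta * x], when [x > 0].  The iterates of [left_map] produce the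
    quasi-greedy expansion, which never terminates. *)
Definition left_digit x : nat :=
  (dgt x - ((dgt x)%:R == beta * x)%R)%N.

Definition left_map x : R := beta * x - (left_digit x)%:R.

Lemma left_digit_regular x : (dgt x)%:R != beta * x -> left_digit x = dgt x.
Proof. by rewrite /left_digit => /negbTE ->; rewrite subn0. Qed.

Lemma left_digit_integer x k : beta * x = k.+1%:R -> left_digit x = k.
Proof. by move=> h; rewrite /left_digit h Num.Theory.natrK eqxx subn1. Qed.

Lemma left_map_itv x : 0 < x -> 0 < left_map x <= 1.
Proof.
move=> x0; have bx0 : 0 < beta * x by rewrite mulr_gt0.
have /andP[lo hi] := Num.Theory.truncn_itv (ltW bx0).
rewrite /left_map; have [h|h] := eqVneq ((dgt x)%:R) (beta * x).
  case E : (dgt x) h => [|k] h; first by rewrite -h ltxx in bx0.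
  rewrite (@left_digit_integer x k) -?h// -natr1 addrAC subrr add0r.
  by rewrite ltr01 lexx.
rewrite left_digit_regular// subr_gt0 lt_neqAle h lo/=.
by rewrite lerBlDr addrC natr1 ltW.
Qed.

Lemma left_map01 x : 0 < x <= 1 -> 0 < left_map x <= 1.
Proof. by case/andP=> x0 _; exact: left_map_itv. Qed.

Lemma left_digit_le x : x <= 1 -> (left_digit x <= Num.truncn beta)%N.
Proof. by move=> x1; apply: leq_trans (leq_subr _ _) (digit_le x1). Qed.

Lemma iter_left_map_le n x : 0 < x -> 0 < iter n left_map x <= beta ^+ n * x.
Proof.
move=> x0; elim: n => [|n /andP[h1 h2]]; first by rewrite expr0 mul1r x0/=.
rewrite iterS; have /andP[-> _] := left_map_itv h1 => /=.
rewrite exprS -mulrA; apply: le_trans (_ : beta * iter n left_map x <= _).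
  by rewrite lerBlDr lerDl.
by rewrite ler_pM2l.
Qed.

End beta_map.

(** * The function F and its one-sided limits *)

Section expansion.
Variables (R : realType) (beta : R).
Hypothesis beta_gt1 : 1 < beta.
Variable lambda : R[i].
Hypothesis lambda_gt : beta^-1 < normc lambda.
Implicit Types x y : R.

Notation T := (beta_map beta).
Notation T' := (left_map beta).
Notation dgt x := (Num.truncn (beta * x)).
Notation F := (F beta lambda).

Let beta_gt0 : 0 < beta. Proof. exact: lt_trans beta_gt1. Qed.

Definition ratio : R[i] := (beta%:C * lambda)^-1.
Notation z := ratio.

Lemma lambda_neq0 : lambda != 0.
Proof.
apply: contraTneq lambda_gt => ->.
by rewrite normc0 -leNgt invr_ge0 ltW.
Qed.

Lemma betac_neq0 : beta%:C != 0 :> R[i].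
Proof. by rewrite -normc_gt0 normc_real normr_gt0 gt_eqF. Qed.

Lemma ratio_neq0 : z != 0.
Proof. by rewrite invr_eq0 mulf_neq0 ?betac_neq0 ?lambda_neq0. Qed.

Lemma ratioE : lambda * z = (beta^-1)%:C.
Proof.
rewrite /ratio invfM mulrCA mulfV ?lambda_neq0// mulr1.
by apply/esym; exact: (fmorphV (real_complex R)).
Qed.

Lemma normc_ratio : normc z = (beta * normc lambda)^-1.
Proof. by rewrite normcV normcM normc_real gtr0_norm. Qed.

Lemma normc_ratio_lt1 : normc z < 1.
Proof.
rewrite normc_ratio invf_lt1 ?mulr_gt0 ?normc_gt0 ?lambda_neq0//.
by rewrite mulrC -ltr_pdivrMr// div1r.
Qed.

Lemma normc_ratio01 : 0 <= normc z < 1.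
Proof. by rewrite normc_ge0 normc_ratio_lt1. Qed.

Let phi x : R[i] := (dgt x)%:R.
Let B : R := (Num.truncn beta)%:R.

Let phiB x : 0 <= x <= 1 -> normc (phi x) <= B.
Proof.
by case/andP => _ /(digit_le beta_gt1) h; rewrite normc_natr ler_nat.
Qed.

Let F_orbit_sum x : 0 <= x <= 1 -> F x = z * orbit_sum T phi z x.
Proof.
move=> x01; apply: (cvg_lim (@norm_hausdorff _ R[i]^o)).
rewrite -cvg_shiftS.
rewrite (_ : (fun n => _) =
    (fun N => z * \sum_(0 <= n < N) z ^+ n * phi (iter n T x))); last first.
  apply/funext => N; rewrite big_add1/= mulr_sumr; apply: eq_bigr => n _.
  by rewrite /digit/= mulrA -exprS mulrC -exprMn exprVn.
apply: cvgMr.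
exact: (orbit_sum_cvg normc_ratio_lt1 (beta_map01 beta_gt1) phiB x01).
Qed.

Lemma F_rec x : 0 <= x <= 1 -> F x = z * ((dgt x)%:R + F (T x)).
Proof.
move=> x01; rewrite !F_orbit_sum ?beta_map01//.
by rewrite (orbit_sumE normc_ratio_lt1 (beta_map01 beta_gt1) phiB x01).
Qed.

Lemma F_bounded : exists K : R, forall x, 0 <= x <= 1 -> normc (F x) <= K.
Proof.
exists (normc z * (B / (1 - normc z))) => x x01.
rewrite F_orbit_sum// normcM ler_wpM2l ?normc_ge0//.
exact: (orbit_sum_bound normc_ratio_lt1 (beta_map01 beta_gt1) phiB x01).
Qed.

(** The digit series of the quasi-greedy expansion; it is the left limit of [F]
    at [x], by [F_left_limit]. *)
Definition F_left x : R[i]^o :=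
  z * orbit_sum T' (fun x => (left_digit beta x)%:R) z x.

Let phi'B x : 0 < x <= 1 -> normc ((left_digit beta x)%:R : R[i]) <= B.
Proof.
by case/andP => _ /(left_digit_le beta_gt1) h; rewrite normc_natr ler_nat.
Qed.

Lemma F_left_rec x : 0 < x <= 1 ->
  F_left x = z * ((left_digit beta x)%:R + F_left (T' x)).
Proof.
move=> x01; congr (_ * _).
exact: (orbit_sumE normc_ratio_lt1 (left_map01 beta_gt1) phi'B x01).
Qed.

Lemma F_left_bounded :
  exists K : R, forall x, 0 < x <= 1 -> normc (F_left x) <= K.
Proof.
exists (normc z * (B / (1 - normc z))) => x x01.
rewrite normcM ler_wpM2l ?normc_ge0//.
exact: (orbit_sum_bound normc_ratio_lt1 (left_map01 beta_gt1) phi'B x01).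
Qed.

Lemma F0 : F 0 = 0.
Proof.
have [K hK] := F_bounded.
apply: (@contraction_eq0 _ R (fun x => x = 0) T F z K normc_ratio_lt1) => //.
- by move=> x ->; exact: beta_map0.
- move=> x ->.
  by rewrite {1}F_rec ?lexx ?ler01// mulr0 Num.Theory.truncn0 add0r.
- by move=> x ->; rewrite hK// lexx ler01.
Qed.

(** Near [x], on its right, points share the first [n] digits of [x], so the
    functional equation can be unrolled [n] times for both. *)
Lemma F_right_cylinder n x : 0 <= x < 1 -> exists2 d : R, 0 < d &
  forall y, x <= y < x + d -> y <= 1 /\ 
    F y - F x = z ^+ n * (F (iter n T y) - F (iter n T x)).
Proof.
elim: n x => [|n IH] x /andP[x0 x1].
  exists (1 - x); first by rewrite subr_gt0.
  by move=> y /andP[_]; rewrite addrC subrK expr0 mul1r => /ltW.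
have /andP[t0 t1] := beta_map_itv beta_gt1 x0.
have [|d d0 hd] := IH (T x); first by rewrite t0.
exists (Num.min (Num.min d (1 - T x) / beta) (1 - x)).
  by rewrite lt_min subr_gt0 x1 andbT divr_gt0// lt_min d0 subr_gt0.
move=> y /andP[xy]; rewrite -ltrBlDl lt_min => /andP[].
rewrite ltr_pdivlMr// lt_min.
move=> /andP[h1 h2]; rewrite ltrBlDr subrK => /ltW y1; split=> //.
have dE : dgt y = dgt x.
  apply: digit_uniq; have bxy : beta * x <= beta * y by rewrite ler_pM2l.
  by move: t0 h2; rewrite beta_mapE => *; apply/andP; split; lra.
have TE : T y = T x + (y - x) * beta by rewrite !beta_mapE dE; ring.
have [|_ e] := hd (T y).
  rewrite TE lerDl ltrD2l h1 andbT mulr_ge0 ?subr_ge0//; exact: ltW.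
rewrite (F_rec (x := y)) ?y1 ?(le_trans x0)// (F_rec (x := x)) ?x0 ?ltW//.
by rewrite dE -mulrBr opprD addrACA subrr add0r e mulrA -exprS -!iterSr.
Qed.

Lemma F_right_continuous x : 0 <= x < 1 -> right_continuous_at F x.
Proof.
move=> x01; apply/cvg_normcP => e e0; have [K hK] := F_bounded.
have [n hn] := expr_small (K + K) normc_ratio01 e0.
have [d d0 hd] := F_right_cylinder n x01.
have x1 : x < x + d by rewrite ltrDl.
near=> y.
have xy : x < y by near: y; exact: nbhs_right_gt.
have [|y1 h] := hd y; first by rewrite ltW//=; near: y; exact: nbhs_right_lt.
have /andP[x0 /ltW x1'] := x01.
rewrite normcB h normcM normcX; apply: le_lt_trans hn.
rewrite ler_wpM2l ?exprn_ge0 ?normc_ge0//.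
apply: le_trans (le_normcD _ _) _; rewrite normcN.
by rewrite lerD// hK// iter_beta_map01// ?x0//= y1 (le_trans x0) ?ltW.
Unshelve. all: by end_near. Qed.

(** The interval from [x - beta ^- n * T'^n x] to [x] is a cylinder of order [n]
    cut at [x]: on it the first [n] digits are the quasi-greedy digits of [x],
    and [T^n] is affine with slope [beta ^ n], vanishing at the left end. *)
Lemma F_left_cylinder n x y : 0 < x <= 1 ->
  x - beta ^- n * iter n T' x <= y < x ->
  [/\ 0 <= y, iter n T y = iter n T' x - beta ^+ n * (x - y) &
    F y - F_left x = z ^+ n * (F (iter n T y) - F_left (iter n T' x))].
Proof.
elim: n x y => [|n IH] x y /andP[x0 x1].
  rewrite expr0 invr1 !mul1r subrr /= => /andP[-> _].
  by split=> //; ring.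
move=> /andP[ly yx].
have /andP[i0 iB] := iter_left_map_le beta_gt1 n.+1 x0.
have bn0 : 0 < beta ^+ n.+1 by rewrite exprn_gt0.
have y0 : 0 <= y.
  apply: le_trans ly; rewrite subr_ge0 mulrC ler_pdivrMr//.
  by rewrite mulrC.
have /andP[t0 t1] := left_map_itv beta_gt1 x0.
have /andP[j0 jB] := iter_left_map_le beta_gt1 n t0.
have ly' : x - y <= beta ^- n.+1 * iter n T' (T' x).
  by rewrite -iterSr; lra.
have key : (x - y) * beta <= beta ^- n * iter n T' (T' x).
  by rewrite -ler_pdivlMr// [leRHS]mulrAC -invfM -exprSr.
have key2 : (x - y) * beta <= T' x.
  apply: le_trans key _; rewrite mulrC ler_pdivrMr ?exprn_gt0//.
  by rewrite mulrC.
have bxy : beta * y < beta * x by rewrite ltr_pM2l.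
have dE : dgt y = left_digit beta x.
  apply: digit_uniq; move: t1 key2; rewrite /left_map => *.
  by apply/andP; split; lra.
have TE : T y = T' x - (x - y) * beta by rewrite beta_mapE /left_map dE; ring.
have [||_ e1 e2] := IH (T' x) (T y); first by rewrite t0.
  rewrite TE lerD2l lerN2 key/= gtrDl oppr_lt0 mulr_gt0// subr_gt0//.
split=> //.
  by rewrite !iterSr e1 TE exprSr -mulrA; congr (_ - _ * _); ring.
rewrite F_left_rec ?x0// F_rec ?y0 ?(le_trans (ltW yx))//.
by rewrite dE -mulrBr opprD addrACA subrr add0r e2 mulrA -exprS -!iterSr.
Qed.

Lemma F_left_limit x : 0 < x <= 1 -> F y @[y --> x^'-] --> F_left x.
Proof.
move=> x01; apply/cvg_normcP => e e0; have [K hK] := F_bounded.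
have [K' hK'] := F_left_bounded.
have [n hn] := expr_small (K + K') normc_ratio01 e0.
have /andP[x0 x1] := x01.
have it01 : 0 < iter n T' x <= 1.
  by elim: {hn} n => [|n IH] //; rewrite iterS left_map01.
have /andP[i0 _] := iter_left_map_le beta_gt1 n x0.
have lx : x - beta ^- n * iter n T' x < x.
  by rewrite gtrDl oppr_lt0 mulr_gt0// invr_gt0 exprn_gt0.
near=> y.
have yx : y < x by near: y; exact: nbhs_left_lt.
have [|y0 _ h] := @F_left_cylinder n x y x01.
  by rewrite yx andbT ltW//; near: y; exact: nbhs_left_gt.
rewrite normcB h normcM normcX; apply: le_lt_trans hn.
rewrite ler_wpM2l ?exprn_ge0 ?normc_ge0//.
apply: le_trans (le_normcD _ _) _; rewrite normcN.
by rewrite lerD// ?hK ?hK' ?iter_beta_map01// ?y0/= ?(le_trans (ltW yx)).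
Unshelve. all: by end_near. Qed.

Lemma left_continuousE x : 0 < x <= 1 ->
  left_continuous_at F x <-> F_left x = F x.
Proof.
move=> x01; split => [h|e]; last first.
  by rewrite /left_continuous_at -e; exact: F_left_limit.
exact: (cvg_unique (@norm_hausdorff _ R[i]^o) (F_left_limit x01) h).
Qed.

Lemma simple_integer x k : x <= 1 -> beta * x = k.+1%:R -> simple_number beta x.
Proof.
move=> x1 h; exists 1%N => //; exists k.+1; last first.
  by rewrite -h [beta * x]mulrC mulfK ?gt_eqF.
rewrite /= -(@Num.Theory.natrK R k.+1) -h.
exact: digit_le.
Qed.

Lemma simple_beta_map x : simple_number beta (T x) -> simple_number beta x.
Proof.
move=> [[|n]// _ [k kb e]]; exists n.+2 => //.
by exists k => //; rewrite iterSr.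
Qed.

Lemma nonsimple_regular x : 0 < x <= 1 -> ~ simple_number beta x ->
  (dgt x)%:R != beta * x.
Proof.
case/andP=> x0 x1 ns; apply: contra_notN ns => /eqP e.
have bx0 : 0 < beta * x by rewrite mulr_gt0.
case: (dgt x) e => [|k] e; first by rewrite -e ltxx in bx0.
exact: simple_integer x1 (esym e).
Qed.

Lemma F_left_nonsimple x : 0 < x <= 1 -> ~ simple_number beta x ->
  F_left x = F x.
Proof.
move=> x01 ns; have [K hK] := F_bounded; have [K' hK'] := F_left_bounded.
apply/eqP; rewrite -subr_eq0; apply/eqP.
pose P y := 0 < y <= 1 /\ ~ simple_number beta y.
have PT y : P y -> T' y = T y.
  by move=> [y01 yns]; rewrite /left_map left_digit_regular// nonsimple_regular.
apply: (@contraction_eq0 _ R P T' (fun y => F_left y - F y) z (K' + K)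
  normc_ratio_lt1) => //.
- move=> y Py; have [y01 yns] := Py; split; first exact: left_map01.
  by rewrite PT// => /simple_beta_map.
- move=> y Py; have [y01 yns] := Py; have /andP[y0 y1] := y01.
  rewrite F_left_rec// {1}F_rec ?y1 ?ltW//.
  by rewrite left_digit_regular ?nonsimple_regular// PT//; ring.
- move=> y [/andP[y0 y1] _]; apply: le_trans (le_normcD _ _) _.
  by rewrite normcN lerD// ?hK ?hK' ?y0 ?y1 ?ltW.
Qed.

(** At such a point the greedy digit is [k.+1] followed by zeros, whereas the
    quasi-greedy digit is [k] followed by the quasi-greedy expansion of 1. *)
Lemma F_integer_jump x k : 0 < x <= 1 -> beta * x = k.+1%:R ->
  F x - F_left x = z * (1 - F_left 1).
Proof.
move=> x01 bx; have /andP[x0 x1] := x01.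
have T'x : T' x = 1.
  by rewrite /left_map (left_digit_integer bx) bx -natr1 addrAC subrr add0r.
rewrite F_rec ?x1 ?ltW// F_left_rec// T'x (left_digit_integer bx).
rewrite beta_mapE bx Num.Theory.natrK subrr F0 addr0.
have -> : (k.+1%:R : R[i]^o) = k%:R + 1 by rewrite mulrSr.
by ring.
Qed.

Lemma F_simple_jump x : 0 < x <= 1 -> simple_number beta x ->
  exists j, F x - F_left x = z ^+ j.+1 * (1 - F_left 1).
Proof.
move=> x01 [[|n]// _ [k]]; rewrite -pred_Sn => /andP[k0 kb].
elim: n x x01 => [|n IH] x x01; have /andP[x0 x1] := x01 => hx.
  exists 0%N; have bx : beta * x = k.-1.+1%:R.
    by rewrite (_ : x = k%:R / beta)// mulrC divfK ?gt_eqF// prednK.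
  by rewrite expr1; exact: F_integer_jump bx.
have [e|ne] := eqVneq ((dgt x)%:R) (beta * x).
  case: (posnP (dgt x)) e => [->|d0] e.
    by have := mulr_gt0 beta_gt0 x0; rewrite -e ltxx.
  exists 0%N; have bx : beta * x = (dgt x).-1.+1%:R by rewrite prednK.
  by rewrite expr1; exact: F_integer_jump bx.
have TE : T' x = T x by rewrite /left_map left_digit_regular.
have [||j hj] := IH (T x); first by rewrite -TE left_map01.
  by rewrite -iterSr.
exists j.+1; rewrite F_rec ?x1 ?ltW// F_left_rec// left_digit_regular// TE.
by rewrite exprS -mulrA -hj; ring.
Qed.

(** If 1 is simple, the jump formula at [x = 1] reads
    [F 1 - 1 = (F_left 1 - 1) * (1 - z ^ j)], and the last factor is nonzero. *)
Lemma F_left1 : F_left 1 = 1 <-> F 1 = 1.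
Proof.
have one : 0 < (1 : R) <= 1 by rewrite ltr01 lexx.
have [s|ns] := pselect (simple_number beta 1); last first.
  by rewrite F_left_nonsimple.
have [j hj] := F_simple_jump one s.
have zj : 1 - z ^+ j.+1 != 0.
  rewrite subr_eq0; apply/eqP => /(congr1 (@normc R)).
  rewrite normc1 normcX => e.
  have : normc z ^+ j.+1 < 1 by rewrite exprn_ilt1 ?normc_ge0 ?normc_ratio_lt1.
  by rewrite -e ltxx.
split=> [e|e].
  by move: hj; rewrite e subrr mulr0 => /eqP; rewrite subr_eq0 => /eqP ->.
have : (1 - F_left 1) * (1 - z ^+ j.+1) = 0.
  by rewrite e in hj; rewrite mulrBr mulr1 mulrC -hj subrr.
move/eqP; rewrite mulf_eq0 (negbTE zj) orbF subr_eq0 => /eqP <- //.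
Qed.

Lemma left_continuous_simple x : 0 < x <= 1 -> simple_number beta x ->
  left_continuous_at F x <-> F 1 = 1.
Proof.
move=> x01 s; rewrite left_continuousE// -F_left1.
have [j hj] := F_simple_jump x01 s.
split=> [e|e]; last first.
  by move: hj; rewrite e subrr mulr0 => /eqP; rewrite subr_eq0 => /eqP ->.
move: hj; rewrite e subrr => /esym/eqP.
by rewrite mulf_eq0 expf_eq0 (negbTE ratio_neq0)/= subr_eq0 => /eqP.
Qed.

End expansion.

(** * Lipschitz continuity and differentiability *)

Section differentiability.
Variables (R : realType) (beta : R).
Hypothesis beta_gt1 : 1 < beta.
Variable lambda : R[i].
Hypothesis lambda_gt : beta^-1 < normc lambda.
Implicit Types x y : R.

Notation T := (beta_map beta).
Notation T' := (left_map beta).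
Notation dgt x := (Num.truncn (beta * x)).
Notation F := (F beta lambda).
Notation z := (ratio beta lambda).

Let beta_gt0 : 0 < beta. Proof. exact: lt_trans beta_gt1. Qed.
Let F_rec := F_rec beta_gt1 lambda_gt.
Let F_bounded := F_bounded beta_gt1 lambda_gt.
Let z1 := normc_ratio_lt1 beta_gt1 lambda_gt.

Lemma F_id x : lambda = 1 -> 0 <= x <= 1 -> F x = x%:C.
Proof.
move=> l1 x01; have [K hK] := F_bounded.
apply/eqP; rewrite -subr_eq0; apply/eqP.
have ze : z = (beta^-1)%:C by rewrite -(ratioE beta_gt1 lambda_gt) l1 mul1r.
apply: (@contraction_eq0 _ R (fun x => 0 <= x <= 1) T (fun y => F y - y%:C) z
  (K + 1) z1) => //; first exact: beta_map01.
- move=> y y01.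
  have yE : y%:C = z * ((dgt y)%:R + (T y)%:C).
    rewrite ze -(rmorph_nat (real_complex R)) -rmorphD -rmorphM/=.
    by rewrite beta_mapE addrC subrK mulKf ?gt_eqF.
  by rewrite F_rec// [y%:C]yE; ring.
- move=> y /[dup] y01 /andP[y0 y1]; apply: le_trans (le_normcD _ _) _.
  by rewrite normcN normc_real ger0_norm// lerD// hK.
Qed.

Lemma normc_F_le x : 1 <= normc lambda -> 0 <= x <= 1 -> normc (F x) <= x.
Proof.
move=> l1 x01; have [K hK] := F_bounded; rewrite -subr_le0.
apply: (@contraction_le0 _ R (fun x => 0 <= x <= 1) T (fun y => normc (F y) - y)
  beta^-1 K) => //.
- by rewrite invr_ge0 ltW//= invf_lt1.
- exact: beta_map01.
- move=> y y01; have /andP[y0 y1] := y01.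
  rewrite {1}F_rec// normcM lerBlDr.
  have zb : normc z <= beta^-1.
    rewrite (normc_ratio beta_gt1) lef_pV2 ?posrE ?mulr_gt0 ?normc_gt0//.
      by rewrite ler_peMr// ltW.
    exact: lambda_neq0 lambda_gt.
  have yE : y = beta^-1 * ((dgt y)%:R + T y).
    by rewrite beta_mapE addrC subrK mulKf ?gt_eqF.
  rewrite [leRHS](_ : _ = beta^-1 * ((dgt y)%:R + normc (F (T y)))); last first.
    by rewrite {3}yE; ring.
  apply: ler_pM; rewrite ?normc_ge0//.
  by apply: le_trans (le_normcD _ _) _; rewrite normc_natr.
- by move=> y /[dup] y01 /andP[y0 y1]; rewrite lerBlDr ler_wpDr// hK.
Qed.

(** The functional equation at 1 reads [beta * lambda = d + F (T 1)], with
    [d = d 1 >= 1] the first digit of 1 and [|F (T 1)| <= T 1 = beta - d].  As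
    [|beta * lambda| = beta], equality holds in the triangle inequality, which
    forces [lambda] to be a nonnegative real. *)
Lemma unimodular_eq1 : normc lambda = 1 -> F 1 = 1 -> lambda = 1.
Proof.
move=> l1 F1; have one : 0 <= (1 : R) <= 1 by rewrite ler01 lexx.
have w : normc (F (T 1)) <= T 1 by rewrite normc_F_le ?l1 ?beta_map01.
have d1 : (1 : R) <= (dgt 1)%:R.
  by rewrite ler1n Num.Theory.truncn_gt_nat mulr1 ltW.
have e : F (T 1) = beta%:C * lambda - (dgt 1)%:R.
  have /esym := F_rec one; rewrite F1.
  move=> /(canRL (mulKf (ratio_neq0 beta_gt1 lambda_gt))).
  rewrite invrK => h; rewrite -[beta%:C * lambda]mulr1 -h.
  by rewrite addrAC subrr add0r.
rewrite {}e beta_mapE in w; move: w l1; rewrite -(rmorph_nat (real_complex R)).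
case: lambda => a b; set d := (dgt 1)%:R in d1 *.
rewrite mulr1 /normc /= !mul0r subr0 addr0 => w l1.
have := w; rewrite -[leRHS]ger0_norm; last exact: le_trans (sqrtr_ge0 _) w.
rewrite -sqrtr_sqr ler_sqrt ?sqr_ge0// => {}w.
have {}l1 : a ^+ 2 + b ^+ 2 = 1.
  have s0 : 0 <= a ^+ 2 + b ^+ 2 by rewrite addr_ge0 ?sqr_ge0.
  by rewrite -[LHS](sqr_sqrtr s0) l1 expr1n.
have a1 : 1 <= a.
  have bd : 0 < beta * d by rewrite mulr_gt0// (lt_le_trans ltr01).
  by rewrite -(ler_pM2l bd); nra.
have b0 : b = 0 by apply/eqP; rewrite -sqrf_eq0 eq_le sqr_ge0 andbT; nra.
have {}a1 : a = 1 by rewrite b0 in l1; nra.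
by rewrite a1 b0.
Qed.

Lemma F_inv_power k : F (beta ^- k.+1) = z ^+ k.+1.
Proof.
have b01 n : 0 <= beta ^- n <= 1.
  rewrite invr_ge0 exprn_ge0 ?(ltW beta_gt0)//= invf_le1 ?exprn_gt0//.
  by rewrite exprn_ege1// ltW.
elim: k => [|k IH]; rewrite F_rec//.
  have e : beta * beta ^- 1 = 1%:R by rewrite expr1 mulfV ?gt_eqF.
  rewrite beta_mapE e Num.Theory.natrK subrr (F0 beta_gt1 lambda_gt).
  by rewrite addr0 mulr1.
have e : beta * beta ^- k.+2 = beta ^- k.+1.
  by rewrite exprS invfM mulrA mulfV ?mul1r ?gt_eqF.
have de : dgt (beta ^- k.+2) = 0%N.
  apply: digit_uniq; rewrite e; case/andP: (b01 k.+1) => -> _.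
  by rewrite add0r invf_lt1 ?exprn_gt0// exprn_egt1.
by rewrite beta_mapE de subr0 e add0r IH [RHS]exprS.
Qed.

(** Take for [u] the left end of the cylinder of order [N] that ends at [x] and
    for [w] the point at distance [beta ^- (N + m)] from it, where [m] is the
    least integer with [beta ^- m < T'^N x].  The cylinder is taken to the left
    of [x] so that the endpoint 1 needs no separate treatment, and the
    minimality of [m] makes the distance from [u] to [x] at most
    [beta * (w - u)]. *)
Lemma steep_pair x N : 0 <= x <= 1 -> exists k u w,
  [/\ (N <= k)%N, 0 <= u <= 1, 0 <= w <= 1, w - u = beta ^- k /\
      F w - F u = z ^+ k &
      `|u - x| <= beta * beta ^- k /\ `|w - x| <= beta * beta ^- k].
Proof.
move=> /andP[]; rewrite le_eqVlt => /predU1P[<- _|x0 x1].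
  exists N.+1, 0, (beta ^- N.+1).
  have b0 : 0 <= beta ^- N.+1 by rewrite invr_ge0 exprn_ge0 ?ltW.
  split; rewrite ?lexx ?ler01 ?subr0 ?F_inv_power//.
  - by rewrite b0/= invf_le1 ?exprn_gt0// exprn_ege1// ltW.
  - by rewrite (F0 beta_gt1 lambda_gt) subr0.
  rewrite normr0 mulr_ge0 ?(ltW beta_gt0)//; split=> //.
  by rewrite ger0_norm// ler_peMl// ltW.
have x01 : 0 < x <= 1 by rewrite x0.
set t := iter N T' x.
have t01 : 0 < t <= 1.
  by rewrite /t; elim: N {t} => [|n IH] //; rewrite iterS left_map01.
have /andP[t0 t1] := t01.
have bn0 n : 0 < beta ^- n by rewrite invr_gt0 exprn_gt0.
have exm : exists m, beta ^- m < t.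
  have [|m hm] := @expr_small R beta^-1 1 t _ t0.
    by rewrite invr_ge0 ltW//= invf_lt1.
  by exists m; rewrite -exprVn -[X in X < _]mulr1.
case: (ex_minnP exm) => -[|m]; first by rewrite expr0 invr1 ltNge t1.
move=> mt mmin.
have tm : t <= beta ^- m.
  by rewrite leNgt; apply/negP => /mmin; rewrite ltnn.
pose u := x - beta ^- N * t; pose w := u + beta ^- (N + m.+1).
have eb : beta ^- (N + m.+1) = beta ^- N * beta ^- m.+1.
  by rewrite exprD invfM.
have bm : beta * beta ^- m.+1 = beta ^- m.
  by rewrite exprS invfM mulrA mulfV ?mul1r ?gt_eqF.
have ub : beta ^- N * t <= beta * beta ^- (N + m.+1).
  by rewrite eb mulrCA bm ler_pM2l.
have ux : u < x by rewrite /u gtrDl oppr_lt0 mulr_gt0.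
have wx : w < x.
  by rewrite /w /u eb -addrA gtrDl addrC subr_lt0 ltr_pM2l.
have uw : u < w by rewrite /w ltrDl.
have [|u0 eu Fu] := @F_left_cylinder _ _ beta_gt1 _ lambda_gt N x u x01.
  by rewrite ux lexx.
have [|w0 ew Fw] := @F_left_cylinder _ _ beta_gt1 _ lambda_gt N x w x01.
  by rewrite wx ltW.
have bV : beta ^+ N * beta ^- N = 1 by rewrite mulfV// expf_neq0// gt_eqF.
have xu : x - u = beta ^- N * t by rewrite /u; ring.
have {}eu : iter N T u = 0.
  by rewrite eu xu mulrA bV mul1r subrr.
have {}ew : iter N T w = beta ^- m.+1.
  rewrite ew (_ : x - w = beta ^- N * (t - beta ^- m.+1)).
    by rewrite mulrA bV mul1r opprB addrC subrK.
  by rewrite /w /u eb; ring.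
exists (N + m.+1)%N, u, w; split.
- exact: leq_addr.
- by rewrite u0 (le_trans (ltW ux)).
- by rewrite w0 (le_trans (ltW wx)).
- split; first by rewrite /w addrAC subrr add0r.
  rewrite -[LHS](subrKA (F_left beta lambda x)) -[_ - F u]opprB.
  rewrite Fu Fw eu ew F_inv_power.
  by rewrite (F0 beta_gt1 lambda_gt) exprD; ring.
by rewrite !ler0_norm ?subr_le0 ?(ltW ux) ?(ltW wx)// !opprB; split; lra.
Qed.

Lemma ratio_outgrows C : normc lambda < 1 ->
  exists N, forall k, (N <= k)%N -> C * beta ^- k < normc z ^+ k.
Proof.
move=> l1; have [|N hN] := @expr_small R (normc lambda) `|C| 1 _ ltr01.
  by rewrite normc_ge0.
exists N => k Nk; rewrite (normc_ratio beta_gt1) exprVn exprMn invfM mulrC.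
rewrite ltr_pM2l ?invr_gt0 ?exprn_gt0//.
have l0 : 0 < normc lambda by rewrite normc_gt0 (lambda_neq0 beta_gt1).
rewrite -div1r ltr_pdivlMr ?exprn_gt0// mulrC; apply: le_lt_trans hN.
apply: le_trans (_ : normc lambda ^+ k * `|C| <= _).
  by rewrite ler_wpM2l ?exprn_ge0 ?ler_norm// ltW.
by rewrite ler_wpM2r// ler_wiXn2l// ltW.
Qed.

Lemma F_not_lipschitz : normc lambda < 1 -> ~ lipschitz01 F.
Proof.
move=> l1 [K hK]; have [N hN] := ratio_outgrows K l1.
have zero01 : 0 <= (0 : R) <= 1 by rewrite lexx ler01.
have [k [u [w [Nk u01 w01 [uw Fuw] _]]]] := steep_pair N zero01.
have := hK w u w01 u01; rewrite normr_normc lecR uw Fuw normcX.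
rewrite gtr0_norm ?invr_gt0 ?exprn_gt0//.
by rewrite leNgt hN.
Qed.

Lemma F_not_differentiable x : normc lambda < 1 -> 0 <= x <= 1 ->
  ~ differentiable_at01 F x.
Proof.
move=> l1 x01 [l /cvg_normcP/(_ 1 ltr01)].
rewrite near_withinE /dnbhs near_withinE => /nbhs_ballP[d /= d0 hd].
have {}hd y : 0 <= y <= 1 -> `|y - x| < d ->
    normc (F y - F x - l * (y - x)%:C) <= `|y - x|.
  move=> y01 yd; have [->|yx] := eqVneq y x.
    by rewrite !subrr mulr0 subr0 normc0 normr0.
  have yx0 : (y - x)%:C != 0 :> R[i].
    by rewrite -normc_gt0 normc_real normr_gt0 subr_eq0.
  have := hd y; rewrite /ball/= distrC => /(_ yd yx y01) /ltW h.
  rewrite -[F y - F x](mulVKf yx0) [l * _]mulrC -mulrBr normcM normc_real.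
  by rewrite ler_piMr// normcB.
pose C := normc l + beta + beta.
have [N1 h1] := ratio_outgrows C l1.
have [|N2 h2] := @expr_small R beta^-1 beta d _ d0.
  by rewrite invr_ge0 ltW//= invf_lt1.
have [k [u [w [Nk u01 w01 [uw Fuw] [ux wx]]]]] := steep_pair (N1 + N2) x01.
have {}h1 := h1 k (leq_trans (leq_addr _ _) Nk).
have bk : beta * beta ^- k < d.
  apply: le_lt_trans h2; rewrite mulrC ler_pM2r// exprVn.
  rewrite lef_pV2 ?posrE ?exprn_gt0//.
  by rewrite ler_weXn2l ?(ltW beta_gt1)// (leq_trans (leq_addl _ _) Nk).
have hu := hd u u01 (le_lt_trans ux bk).
have hw := hd w w01 (le_lt_trans wx bk).
move: h1; apply/negP; rewrite -leNgt -normcX -Fuw.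
rewrite (_ : F w - F u = (F w - F x - l * (w - x)%:C) -
    (F u - F x - l * (u - x)%:C) + l * (w - u)%:C); last first.
  by rewrite !rmorphB; ring.
apply: le_trans (le_normcD _ _) _; rewrite normcM normc_real uw.
rewrite (ger0_norm (x := beta ^- k)) ?invr_ge0 ?exprn_ge0 ?(ltW beta_gt0)//.
have := le_normcD (F w - F x - l * (w - x)%:C) (- (F u - F x - l * (u - x)%:C)).
rewrite normcN /C !mulrDl; lra.
Qed.

End differentiability.

(** * Functions of bounded variation *)

Lemma cvariation_le_bounded (R : realType) (f : R -> R[i]^o) (K a b : R)
    (s : seq R) :
  (forall x, normc (f x) <= K) ->
  cvariation a b f s <= (size s)%:R * (K + K).
Proof.
move=> fK; elim: s a => [|x s IH] a; first by rewrite cvariation_nil mul0r.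
rewrite cvariation_cons /= -natr1 mulrDl mul1r addrC lerD//.
by apply: le_trans (le_normcD _ _) _; rewrite normcN lerD.
Qed.

(** The indicator of an initial segment jumps at most once along an increasing
    chain, and does not jump at all if the chain starts to the right of [a]. *)
Lemma cvariation_indicator (R : realType) (p a b : R) (s : seq R) :
  path <%R p s ->
  cvariation p b (fun x => (x < a)%R%:R) s <= (p < a)%R%:R.
Proof.
elim: s p => [|x s IH] p; first by rewrite cvariation_nil.
move=> /= /andP[px xs]; rewrite cvariation_cons.
have := IH _ xs; case: (ltP x a) => xa.
  by rewrite (lt_trans px xa) subrr normc0 add0r.
case: (ltP p a) => pa h; first by rewrite sub0r normcN normc1 gerDl.
by rewrite subrr normc0 add0r.
Qed.

Lemma countable_avoid (R : realType) (E : set R) (d : R) : countable E ->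
  d < 1 -> exists2 x, d < x < 1 & ~ E x.
Proof.
move=> cE d1; apply: contrapT => h.
have dE : `]d, 1[%classic `<=` E.
  move=> x /=; rewrite in_itv/= => dx; apply: contrapT => nE.
  by apply: h; exists x.
have := countable_lebesgue_measure0 (sub_countable (subset_card_le dE) cE).
rewrite lebesgue_measure_itv/= lte_fin d1 => /eqP.
by rewrite -EFinD eqe subr_eq0 gt_eqF.
Qed.

Lemma bounded_cvariation_bounded (R : realType) (f : R -> R[i]^o) :
  bounded_cvariation 0 1 f ->
  exists K, forall x, 0 <= x <= 1 -> normc (f x) <= K.
Proof.
move=> bf; have [M hM] := cvariation_chain bf.
exists (normc (f 0) + M) => y /andP[].
rewrite le_eqVlt => /predU1P[<- _|y0 y1].
  by rewrite lerDl; have := hM 0 [::]; rewrite cvariation_nil; apply.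
have := hM 0 [:: y]; rewrite /= y0 lexx y1 => /(_ isT isT isT).
rewrite cvariation_cons cvariation_nil addr0 => h.
rewrite -[f y](subrK (f 0)) addrC.
by apply: le_trans (le_normcD _ _) _; rewrite lerD2l.
Qed.

(** A bounded function has a limit value at 1 along any set accumulating there,
    by compactness of a square in the complex plane. *)
Lemma cluster_value_at1 (R : realType) (f : R -> R[i]^o) (C : set R) :
  bounded_cvariation 0 1 f -> C `<=` `[0, 1[%classic ->
  (forall d : R, d < 1 -> exists2 x, d < x & C x) ->
  exists c : R[i], forall e d : R, 0 < e -> d < 1 ->
    exists p, [/\ d < p, C p & normc (f p - c) < e].
Proof.
move=> /bounded_cvariation_bounded[K hK] C01 Cacc.
have /choice[p hp] (n : nat) : exists x, 1 - n.+1%:R^-1 < x /\ C x.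
  by have [|x ? ?] := Cacc (1 - n.+1%:R^-1); [rewrite gtrDl oppr_lt0|exists x].
have fK n : normc (f (p n)) <= K.
  have := C01 _ (hp n).2; rewrite /= in_itv/= => /andP[p0 p1].
  by rewrite hK// p0 ltW.
pose g n : R * R := (complex.Re (f (p n)), complex.Im (f (p n))).
pose A := `[- K, K]%classic `*` `[- K, K]%classic : set (R * R).
have cA : compact A by apply: compact_setX; exact: segment_compact.
have gA : (g @ \oo) A.
  exists 0%N => // n _; split; rewrite /= in_itv/= -ler_norml.
    exact: le_trans (Re_le_normc _) (fK n).
  exact: le_trans (Im_le_normc _) (fK n).
have [[a b] [_ ab]] := cA (g @ \oo) _ gA.
exists (a +i* b)%C => e d e0 d1.
have [n hn] : exists n : nat, d < 1 - n.+1%:R^-1.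
  have d1' : 0 < 1 - d by rewrite subr_gt0.
  have [n _ /(_ n (leqnn n)) h] := near_infty_natSinv_lt (PosNum d1').
  by exists n; rewrite ltrBrDl -ltrBrDr.
have [||_ [[m nm <-]]] := ab (g @` [set m | (n <= m)%N]) (ball (a, b) (e / 2)).
- by exists n => // m nm; exists m.
- by apply: nbhsx_ballx; rewrite divr_gt0.
move=> [/= h1 h2]; exists (p m); split; last 1 first.
- apply: le_lt_trans (normc_le_sum _) _.
  rewrite [e in X in _ < X]splitr.
  move: h1 h2; rewrite /ball/= => h1 h2.
  by move: (f (p m)) h1 h2 => [u v] /= h1 h2; rewrite ltrD// distrC.
- apply: lt_trans hn _; apply: le_lt_trans (hp m).1.
  by rewrite lerD2l lerN2 lef_pV2 ?posrE// ler_nat ltnS.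
- exact: (hp m).2.
Qed.

(** * The candidate eigenfunction *)

Section parry_function.
Variables (R : realType) (beta : R).
Hypothesis beta_gt1 : 1 < beta.
Variable lambda : R[i].
Hypothesis lambda_gt : beta^-1 < normc lambda.
Implicit Types x y a : R.

Notation T := (beta_map beta).
Notation dgt x := (Num.truncn (beta * x)).
Notation F := (F beta lambda).
Notation z := (ratio beta lambda).

Let beta_gt0 : 0 < beta. Proof. exact: lt_trans beta_gt1. Qed.
Let F_rec := F_rec beta_gt1 lambda_gt.
Let F_bounded := F_bounded beta_gt1 lambda_gt.
Let z1 := normc_ratio_lt1 beta_gt1 lambda_gt.
Let T01 := beta_map01 beta_gt1.

(** [parry a] is the sum over [n] of [z ^ n] times the indicator of
    [[0, T^n a)].  For [lambda = 1], [parry 1] is Parry's invariant density up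
    to normalization. *)
Definition parry a : R -> R[i]^o :=
  fun x => orbit_sum T (fun b => (x < b)%R%:R : R[i]) z a.

Let indB x a : 0 <= a <= 1 -> normc ((x < a)%R%:R : R[i]) <= 1.
Proof. by move=> _; case: (x < a); rewrite ?normc0 ?normc1. Qed.

Lemma parry_rec a x : 0 <= a <= 1 ->
  parry a x = (x < a)%R%:R + z * parry (T a) x.
Proof. exact: (orbit_sumE z1 T01 (indB x)). Qed.

Lemma parry_bounded : exists K : R, forall a x, 0 <= a <= 1 ->
  normc (parry a x) <= K.
Proof.
exists (1 / (1 - normc z)) => a x.
exact: (orbit_sum_bound z1 T01 (indB x)).
Qed.

(** The points [(x + k) / beta] that lie below [a] are counted by
    [k < beta * a - x]: all [k] smaller than the first digit of [a] qualify, and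
    that digit itself qualifies when [x < T a]. *)
Lemma branch_count x a : 0 <= x < 1 -> 0 <= a <= 1 ->
  \sum_(0 <= k < (Num.truncn beta).+1)
    (if branch beta x k then ((x + k%:R) / beta < a)%R%:R else 0)
  = (dgt a)%:R + (x < T a)%R%:R :> R[i].
Proof.
move=> /andP[x0 x1] /andP[a0 a1].
have ba0 : 0 <= beta * a by rewrite mulr_ge0// ltW.
have /andP[lo hi] := Num.Theory.truncn_itv ba0.
have db := digit_le beta_gt1 a1.
transitivity (\sum_(0 <= k < (Num.truncn beta).+1)
    (x + k%:R < beta * a)%R%:R : R[i]).
  apply: eq_bigr => k _; rewrite ltr_pdivrMr// [a * _]mulrC.
  case: ifPn => //; rewrite /branch x1 /= => h; case: ltP => // h'.
  case/negP: h; apply: le_trans (ltW h') _.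
  by rewrite ler_piMr// ltW.
rewrite (big_cat_nat (n := dgt a)) ?leqW//=.
rewrite [X in _ + X]big_ltn ?ltnS//; congr (_ + _); last first.
  rewrite big_nat big1 ?addr0 => [|k /andP[dk _]].
    by rewrite beta_mapE ltrBrDr.
  case: ltP => // h; suff : beta * a < beta * a by rewrite ltxx.
  apply: lt_trans hi _; apply: le_lt_trans h.
  by apply: (@le_trans _ _ k%:R); rewrite ?ler_nat ?lerDr.
rewrite big_nat (eq_bigr (fun=> 1)) => [|k /andP[_ kd]]; last first.
  rewrite (_ : x + k%:R < beta * a)//; apply: lt_le_trans lo.
  apply: (@lt_le_trans _ _ k.+1%:R); last by rewrite ler_nat.
  by rewrite -natr1 addrC ltrD2l.
by rewrite -big_nat sumr_const_nat subn0.
Qed.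

(** Apart from the factor [1 / beta], both sides satisfy, as functions of [a],
    the recursion [S a = d a + 1_(x < T a) + z * S (T a)], where [d a] is the
    first digit of [a]; so they agree by contraction.  For the left side the
    recursion comes from [branch_count]. *)
Lemma transfer_parry a x : 0 <= x < 1 -> 0 <= a <= 1 ->
  transfer beta (parry a) x =
    (beta^-1)%:C * ((dgt a)%:R + F (T a) + parry (T a) x).
Proof.
move=> x01 a01; have /andP[x0 x1] := x01.
rewrite (transferE beta_gt1) ?x0 ?ltW//; congr (_ * _).
pose S b : R[i] := \sum_(0 <= k < (Num.truncn beta).+1)
  (if branch beta x k then parry b ((x + k%:R) / beta) else 0).
have SE b : 0 <= b <= 1 -> S b = (dgt b)%:R + (x < T b)%R%:R + z * S (T b).
  move=> b01; rewrite -(branch_count x01 b01) /S mulr_sumr -big_split/=.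
  apply: eq_bigr => k _; case: ifP => _; last by rewrite mulr0 addr0.
  exact: parry_rec.
apply/eqP; rewrite -subr_eq0; apply/eqP.
have [K hK] := F_bounded; have [K' hK'] := parry_bounded.
pose N := Num.truncn beta.
have SB b : 0 <= b <= 1 -> normc (S b) <= N.+1%:R * K'.
  move=> b01; rewrite /S -/N.
  elim: N.+1 => [|n IH]; first by rewrite big_nil normc0 mul0r.
  rewrite big_nat_recr//=; apply: le_trans (le_normcD _ _) _.
  rewrite [leRHS](_ : _ = n%:R * K' + K'); last by rewrite -natr1; ring.
  rewrite lerD//; case: ifP => _; first exact: hK'.
  by rewrite normc0; exact: le_trans (normc_ge0 _) (hK' b x b01).
apply: (@contraction_eq0 _ R (fun b => 0 <= b <= 1) T
  (fun b => S b - ((dgt b)%:R + F (T b) + parry (T b) x)) z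
  (N.+1%:R * K' + (N%:R + K + K')) z1) => //.
- move=> b b01; rewrite SE// (F_rec (T01 b01)) (parry_rec x (T01 b01)).
  by ring.
- move=> b b01; apply: le_trans (le_normcD _ _) _; rewrite normcN.
  apply: lerD; first exact: SB.
  apply: le_trans (le_normcD _ _) _; apply: lerD; last first.
    by apply: hK'; exact: T01.
  apply: le_trans (le_normcD _ _) _; apply: lerD; last by apply: hK; exact: T01.
  by rewrite normc_natr ler_nat digit_le//; case/andP: b01.
Qed.

Lemma transfer_parry1 x : 0 <= x < 1 ->
  transfer beta (parry 1) x = lambda * (parry 1 x + (F 1 - 1)).
Proof.
move=> x01; have one : 0 <= (1 : R) <= 1 by rewrite ler01 lexx.
rewrite transfer_parry// (parry_rec x one) (F_rec one).
have -> : (x < 1)%R%:R = 1 :> R[i] by case/andP: x01 => _ ->.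
by rewrite -(ratioE beta_gt1 lambda_gt) [LHS]/=; ring.
Qed.

(** The recursion gives [V a <= 1 + |z| * V (T a)] for the variation of
    [parry a] along a fixed chain, whence [V a <= 1 / (1 - |z|)] by contraction;
    the a priori bound it needs may depend on the chain. *)
Lemma parry_bounded_cvariation a : 0 <= a <= 1 ->
  bounded_cvariation 0 1 (parry a).
Proof.
move=> a01; apply/bounded_cvariationP; exists (1 - normc z)^-1 => s [ps _].
have [K hK] := parry_bounded.
have z1' : 1 - normc z != 0 by rewrite subr_eq0 gt_eqF.
rewrite -subr_le0.
apply: (@contraction_le0 _ R (fun b => 0 <= b <= 1) T
  (fun b => cvariation 0 1 (parry b) s - (1 - normc z)^-1) (normc z)
  ((size s)%:R * (K + K))) => //.
- by rewrite normc_ge0 z1.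
- move=> b b01.
  have -> : parry b = z *: parry (T b) + (fun x => (x < b)%R%:R).
    by apply/funext => x; rewrite parry_rec// addrC.
  rewrite lerBlDr; apply: le_trans (cvariation_lin _ _ _ _ _ _) _.
  rewrite mulrBr -addrA lerD2l.
  have -> : - (normc z * (1 - normc z)^-1) + (1 - normc z)^-1 = 1 by field.
  apply: le_trans (cvariation_indicator _ _ ps) _.
  by case: (0 < b).
- move=> b b01; rewrite lerBlDr ler_wpDr ?invr_ge0 ?subr_ge0 ?(ltW z1)//.
  by apply: cvariation_le_bounded => x; exact: hK.
Qed.

(** The first [n] terms of the series vanish beyond the largest of the points
    [a, ..., T^(n-1) a], all of which are smaller than 1. *)
Lemma parry_near1 a e : 0 <= a < 1 -> 0 < e ->
  exists2 d : R, d < 1 & forall x, d < x -> normc (parry a x) < e.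
Proof.
move=> /andP[a0 a1] e0; have [K hK] := parry_bounded.
have [n hn] := expr_small K (normc_ratio01 beta_gt1 lambda_gt) e0.
have [d d1 hd] : exists2 d : R, d < 1 &
    forall x, d < x -> parry a x = z ^+ n * parry (iter n T a) x.
  elim: n a a0 a1 {hn} => [|n IH] a a0 a1.
    by exists 0 => // x _; rewrite expr0 mul1r.
  have /andP[t0 t1] := beta_map_itv beta_gt1 a0.
  have [d d1 hd] := IH _ t0 t1.
  exists (Num.max d a); first by rewrite gt_max d1 a1.
  move=> x; rewrite gt_max => /andP[dx ax].
  rewrite parry_rec ?a0 ?ltW// hd// ltNge (ltW ax) add0r mulrA -exprS.
  by rewrite -iterSr.
exists d => // x dx; rewrite hd// normcM normcX; apply: le_lt_trans hn.
by rewrite ler_wpM2l ?exprn_ge0 ?normc_ge0// hK// iter_beta_map01// a0 ltW.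
Qed.

Lemma parry1_near1 e : 0 < e ->
  exists2 d : R, d < 1 & forall x, d < x < 1 -> normc (parry 1 x - 1) < e.
Proof.
move=> e0; have /andP[t0 t1] := beta_map_itv beta_gt1 (@ler01 R).
have [|d d1 hd] := @parry_near1 (T 1) e _ e0; first by rewrite t0.
exists d => // x /andP[dx x1].
rewrite parry_rec ?ler01 ?lexx// x1 addrAC subrr add0r normcM.
by apply: le_lt_trans (hd x dx); rewrite ler_piMl ?normc_ge0 ?ltW.
Qed.

End parry_function.

(** * Isolated eigenvalues *)

(** The variation of [g] is measured along chains in a set [C] that avoids the
    points where the eigenvalue equation may fail.  The function [g] is extended
    by 0 to the right of 1, and accordingly [C] by [[1, +oo)], so that each
    inverse branch [phi k] can be applied to a whole chain: the points of the
    last branch that leave the interval are sent where [ghat] is 0. *)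
Section branch_contraction.
Variables (R : realType) (beta : R).
Hypothesis beta_gt1 : 1 < beta.
Variable lambda : R[i].
Hypothesis lambda_gt : beta^-1 < normc lambda.
Variables (C : set R) (g : R -> R[i]^o) (kappa : R[i]).
Implicit Types (x y a : R) (s t : seq R).

Let b := Num.truncn beta.
Let phi (k : nat) x := (x + k%:R) / beta.
Let ghat x : R[i]^o := if x < 1 then g x else 0.
Let Chat : set R := C `|` [set x | 1 <= x].
Let chain (D : set R) a s := path <%R a s /\ forall y, y \in a :: s -> D y.

Hypothesis C01 : C `<=` `[0, 1[%classic.
Hypothesis C_branch : forall x k, C x -> (x + k%:R) / beta < 1 ->
  C ((x + k%:R) / beta).
Hypothesis g_transfer : forall x, C x -> lambda * g x + kappa =
  (beta^-1)%:C * \sum_(0 <= k < (Num.truncn beta).+1)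
     (if (x + k%:R) / beta < 1 then g ((x + k%:R) / beta) else 0).
Hypothesis g_vanish : forall e d : R, 0 < e -> d < 1 ->
  exists p, [/\ d < p, C p & normc (g p) < e].

Let beta_gt0 : 0 < beta. Proof. exact: lt_trans beta_gt1. Qed.

Let C_ge0 x : C x -> 0 <= x.
Proof. by move/C01; rewrite /= in_itv/= => /andP[]. Qed.

Let C_lt1 x : C x -> x < 1.
Proof. by move/C01; rewrite /= in_itv/= => /andP[]. Qed.

Let phi_lt k x y : x < y -> phi k x < phi k y.
Proof. by move=> xy; rewrite /phi ltr_pM2r ?invr_gt0// ltrD2r. Qed.

Let path_map_phi k a s : path <%R a s -> path <%R (phi k a) (map (phi k) s).
Proof. by elim: s a => //= x s IH a /andP[/(phi_lt k) -> /IH]. Qed.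

Let phi_Chat k x : C x -> Chat (phi k x).
Proof.
by move=> Cx; case: (ltP (phi k x) 1) => h; [left; exact: C_branch|right].
Qed.

(** The images of a chain under the successive branches follow each other, since
    [phi k] maps [[0, 1)] below [(k + 1) / beta]; joining them only adds the
    nonnegative increments between consecutive images. *)
Let chain_concat a s n : chain C a s -> exists t,
  [/\ chain Chat (phi 0 a) t, last (phi 0 a) t = phi n (last a s) &
   \sum_(0 <= k < n.+1) cvariation (phi k a) 1 ghat (map (phi k) s) <=
     cvariation (phi 0 a) 1 ghat t].
Proof.
move=> [pas Cas].
have Cm k y : y \in phi k a :: map (phi k) s -> Chat y.
  by rewrite -map_cons => /mapP[x /Cas Cx ->]; exact: phi_Chat.
elim: n => [|n [t [[pt Ct] lt le]]].
  exists (map (phi 0) s); split; last by rewrite big_nat1.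
    by split; [exact: path_map_phi|exact: Cm].
  by rewrite last_map.
exists (t ++ phi n.+1 a :: map (phi n.+1) s); split.
- split.
    rewrite cat_path pt/= lt path_map_phi// andbT.
    have Cl : C (last a s) by apply: Cas; exact: mem_last.
    have Ca : C a by apply: Cas; exact: mem_head.
    rewrite /phi ltr_pM2r ?invr_gt0// -natr1.
    by have := C_lt1 Cl; have := C_ge0 Ca; lra.
  move=> y; rewrite -cat_cons mem_cat => /orP[|]; first exact: Ct.
  exact: Cm.
- by rewrite last_cat/= last_map.
- rewrite big_nat_recr//= cvariation_cat cvariation_cons lerD//.
  by rewrite lerDr normc_ge0.
Qed.

Let cvariation_ghat_ge1 a s : 1 <= a -> path <%R a s ->
  cvariation a 1 ghat s = 0.
Proof.
elim: s a => [|x s IH] a a1 /=; first by rewrite cvariation_nil.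
move=> /andP[/ltW ax xs]; have x1 := le_trans a1 ax.
by rewrite cvariation_cons IH// addr0 /ghat !ltNge a1 x1/= subrr; exact: normc0.
Qed.

(** The jump of [ghat] to 0 at 1 costs nothing: ending the chain at a point of
    [C] close to 1, where [g] is small, has the same effect up to [e]. *)
Let chain_cut a s e : 0 < e -> C a -> chain Chat a s -> exists2 t,
  chain C a t & cvariation a 1 ghat s <= cvariation a 1 g t + e.
Proof.
move=> e0; elim: s a => [|x s IH] a Ca [pas Cas].
  exists [::]; first by split=> // y; rewrite inE => /eqP ->.
  by rewrite !cvariation_nil add0r ltW.
move: pas => /= /andP[ax xs].
have [x1|x1] := ltP x 1.
  have Cx : C x.
    have : Chat x by apply: Cas; rewrite !inE eqxx orbT.
    by case=> //=; rewrite leNgt x1.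
  have [|t [pt Ct] ht] := IH x Cx.
    by split=> // y ys; apply: Cas; rewrite inE ys orbT.
  exists (x :: t).
    split; first by rewrite /= ax.
    by move=> y; rewrite inE => /predU1P[->//|]; exact: Ct.
  rewrite !cvariation_cons -addrA lerD//.
  by rewrite /ghat x1 (C_lt1 Ca).
have [p [ap Cp pe]] := g_vanish e0 (C_lt1 Ca).
exists [:: p].
  by split; [rewrite /= ap|move=> y; rewrite !inE => /orP[]/eqP ->].
rewrite !cvariation_cons cvariation_nil cvariation_ghat_ge1// !addr0.
rewrite /ghat (C_lt1 Ca) ltNge x1/= sub0r normcN.
rewrite -{1}[g a](subKr (g p)); apply: le_trans (le_normcD _ _) _.
by rewrite [leRHS]addrC; apply: lerD; [exact: ltW|rewrite normcN].
Qed.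

Let sum_branches a s : chain C a s ->
  normc lambda * cvariation a 1 g s <=
  beta^-1 * \sum_(0 <= k < b.+1) cvariation (phi k a) 1 ghat (map (phi k) s).
Proof.
elim: s a => [|x s IH] a [pas Cas].
  rewrite cvariation_nil mulr0 mulr_ge0 ?invr_ge0 ?(ltW beta_gt0)//.
  by apply: sumr_ge0 => k _; exact: cvariation_ge0.
under eq_bigr do rewrite map_cons cvariation_cons.
rewrite big_split/= mulrDr cvariation_cons mulrDr lerD//; last first.
  apply: IH; split; first by case/andP: pas.
  by move=> y ys; apply: Cas; rewrite inE ys orbT.
have Ca : C a by apply: Cas; exact: mem_head.
have Cx : C x by apply: Cas; rewrite !inE eqxx orbT.
rewrite -normcM (_ : lambda * (g x - g a) =
    (beta^-1)%:C * \sum_(0 <= k < b.+1) (ghat (phi k x) - ghat (phi k a))).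
  rewrite normcM normc_real ger0_norm ?invr_ge0 ?(ltW beta_gt0)//.
  rewrite ler_wpM2l ?invr_ge0 ?(ltW beta_gt0)//.
  elim: b.+1 => [|n IHn]; first by rewrite !big_nil normc0.
  rewrite !big_nat_recr//=; apply: le_trans (le_normcD _ _) _.
  by rewrite lerD2r.
have gE y : C y -> (beta^-1)%:C * \sum_(0 <= k < b.+1) ghat (phi k y) =
    lambda * g y + kappa.
  by move=> Cy; exact/esym/g_transfer.
transitivity ((lambda * g x + kappa) - (lambda * g a + kappa)); first by ring.
by rewrite -(gE x)// -(gE a)// -mulrBr -sumrB.
Qed.

(** One application of the transfer equation improves a bound on the variation
    along chains in [C] by the factor [|z| < 1]. *)
Let chain_step (M : R) :
  (forall a s, chain C a s -> cvariation a 1 g s <= M) ->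
  forall a s, chain C a s ->
    cvariation a 1 g s <= normc (ratio beta lambda) * M.
Proof.
move=> hM a s cas; have Ca : C a by apply: cas.2; exact: mem_head.
have [t [ct _ ht]] := chain_concat b cas.
have l0 : 0 < normc lambda by apply: lt_trans lambda_gt; rewrite invr_gt0.
rewrite (normc_ratio beta_gt1) ler_pdivlMl ?mulr_gt0// -mulrA -ler_pdivlMl//.
apply: le_trans (sum_branches cas) _.
rewrite ler_wpM2l ?invr_ge0 ?(ltW beta_gt0)//.
apply: le_trans ht _; apply/ler_addgt0Pr => e e0.
have [p1|p1] := ltP (phi 0 a) 1.
  have [u cu hu] := chain_cut e0 (C_branch (k := 0) Ca p1) ct.
  by apply: le_trans hu _; rewrite lerD2r hM.
rewrite cvariation_ghat_ge1//; last by case: ct.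
apply: addr_ge0 (ltW e0); apply: le_trans (hM a [::] _).
  by rewrite cvariation_nil.
by split=> // y; rewrite inE => /eqP ->.
Qed.

(** Iterating [chain_step] makes [g] constant on [C], and the constant is 0
    because [g] has limit value 0 at 1. *)
Lemma branch_contraction : bounded_cvariation 0 1 g ->
  forall x, C x -> g x = 0.
Proof.
move=> /cvariation_chain[M hM].
have z01 := normc_ratio01 beta_gt1 lambda_gt.
have hn n a s : chain C a s ->
    cvariation a 1 g s <= normc (ratio beta lambda) ^+ n * M.
  elim: n a s => [|n IH] a s cas.
    rewrite expr0 mul1r; case: cas => pas Cas; apply: hM => //.
      by apply: C_ge0; apply: Cas; exact: mem_head.
    by apply/ltW/C_lt1/Cas; exact: mem_last.
  by rewrite exprS -mulrA; exact: chain_step.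
have g_const x y : C x -> C y -> x < y -> normc (g y - g x) = 0.
  move=> Cx Cy xy; apply/le_anti; rewrite normc_ge0 andbT.
  apply/ler_addgt0Pr => e e0; rewrite add0r.
  have [n hM'] := expr_small M z01 e0.
  apply: le_trans (ltW hM'); have := hn n x [:: y].
  rewrite cvariation_cons cvariation_nil addr0; apply.
  by split; [rewrite /= xy|move=> w; rewrite !inE => /orP[]/eqP ->].
move=> x Cx; apply/eq0_normc/le_anti; rewrite normc_ge0 andbT.
apply/ler_addgt0Pr => e e0; rewrite add0r.
have [p [xp Cp pe]] := g_vanish e0 (C_lt1 Cx).
have /eq0_normc/eqP := g_const x p Cx Cp xp.
by rewrite subr_eq0 => /eqP <-; exact: ltW.
Qed.

End branch_contraction.

Section eigenvalue.
Variables (R : realType) (beta : R).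
Hypothesis beta_gt1 : 1 < beta.
Variable lambda : R[i].
Hypothesis lambda_gt : beta^-1 < normc lambda.
Implicit Types x y a : R.

Notation T := (beta_map beta).
Notation F := (F beta lambda).

Let beta_gt0 : 0 < beta. Proof. exact: lt_trans beta_gt1. Qed.

Lemma parry1_BV : parry beta lambda 1 \in @BV_pred R.
Proof.
apply/asboolP; apply: parry_bounded_cvariation => //.
by rewrite ler01 lexx.
Qed.

Lemma eigenvalue_of_F1 : F 1 = 1 -> isolated_eigenvalue beta_gt1 lambda.
Proof.
move=> F1; split; first by rewrite normr_normc ltcR.
pose h := MkBV parry1_BV; exists (BV_class h).
  rewrite -BV_class0; apply/eqP => /BV_class_eqP/asboolP[A cA hA].
  have [d d1 hd] := parry1_near1 beta_gt1 lambda_gt (@ltr01 R).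
  have md1 : Num.max d 0 < 1 by rewrite gt_max d1 ltr01.
  have [x /andP[]] := countable_avoid cA md1.
  rewrite gt_max => /andP[dx x0] x1 nAx.
  have := hd x; rewrite dx x1 => /(_ isT).
  have := hA x; rewrite !ltW// => /(_ isT nAx).
  rewrite [X in X = _ -> _](_ : _ = parry beta lambda 1 x) => [->|].
    by rewrite sub0r normcN normc1 ltxx.
  by rewrite subr0.
rewrite transfer_BV_class -BV_classZ; apply/BV_class_eqP/asboolP.
exists [set 1]; first exact: countable1.
move=> x /andP[x0 x1] nx; have {}x1 : x < 1.
  by rewrite lt_neqAle x1 andbT; apply/eqP.
rewrite [LHS](_ : _ = transfer beta (parry beta lambda 1) x
  - lambda * parry beta lambda 1 x)//.
rewrite (transfer_parry1 beta_gt1 lambda_gt) ?x0//.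
by rewrite F1 subrr addr0 subrr.
Qed.

Lemma beta_map_branch x k : 0 <= x < 1 -> T ((x + k%:R) / beta) = x.
Proof.
move=> /andP[x0 x1]; rewrite beta_mapE mulrC divfK ?gt_eqF//.
rewrite (@Num.Theory.truncn_def _ _ k) ?addrK// lerDr x0 -natr1 addrC.
by rewrite ltrD2l.
Qed.

(** [E] is the forward orbit of the exceptional countable set and of 1: its
    complement contains all preimages of its points, so that the eigenvalue
    equation holds on it at every stage, and preimages equal to 1 do not
    occur. *)
Lemma F1_of_eigenvalue : isolated_eigenvalue beta_gt1 lambda -> F 1 = 1.
Proof.
move=> [_ [u]]; elim/BVhat_ind: u => f f_neq0.
rewrite transfer_BV_class -BV_classZ => /BV_class_eqP/asboolP[A cA hA].
have bf : bounded_cvariation 0 1 f by case: f {f_neq0 hA} => f /= /asboolP.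
pose E := \bigcup_(i in [set: nat * bool])
  (iter i.1 T @` (if i.2 then A else [set 1])).
have EA y : A y -> E y by move=> Ay; exists (0%N, true) => //; exists y.
have E1 : E 1 by exists (0%N, false) => //; exists 1.
have cE : countable E.
  apply: bigcup_countable => // -[n i] _.
  apply: sub_countable (card_image_le _ _) _.
  by case: i => //; exact: countable1.
have E_map y : E y -> E (T y).
  by move=> [[n i] _ [a Aa <-]]; exists (n.+1, i) => //; exists a.
pose C := [set x : R | 0 <= x < 1 /\ ~ E x].
have C01 : C `<=` `[0, 1[%classic by move=> x [x01 _]; rewrite /= in_itv.
have Cacc d : d < 1 -> exists2 x, d < x & C x.
  move=> d1; have md1 : Num.max d 0 < 1 by rewrite gt_max d1 ltr01.
  have [x /andP[]] := countable_avoid cE md1.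
  rewrite gt_max => /andP[dx x0] x1 nEx.
  by exists x => //; split=> //; rewrite ltW.
have C_branch x k : C x -> ~ E ((x + k%:R) / beta).
  by move=> [x01 nEx] /E_map; rewrite beta_map_branch.
have f_eigen x : C x -> transfer beta f x = lambda * f x.
  move=> [/andP[x0 x1] nEx]; apply/eqP; rewrite -subr_eq0; apply/eqP.
  apply: hA; first by rewrite x0 ltW.
  by move/EA.
have [c hc] := cluster_value_at1 bf C01 Cacc.
pose h := parry beta lambda 1.
have bh : bounded_cvariation 0 1 h by have /asboolP := parry1_BV.
pose g : R -> R[i]^o := (- c) *: h + f.
have gE x : g x = f x - c * h x by rewrite -mulNr addrC.
pose kappa := - (c * lambda * (F 1 - 1)).
have gT x : C x -> transfer beta g x = lambda * g x + kappa.
  move=> Cx; have [x01 _] := Cx; have /andP[x0 x1] := x01.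
  rewrite (transfer_linear beta_gt1) ?x0 ?ltW// f_eigen//.
  by rewrite (transfer_parry1 beta_gt1 lambda_gt)// gE /kappa /h; ring.
have g_transfer x : C x -> lambda * g x + kappa =
    (beta^-1)%:C * \sum_(0 <= k < (Num.truncn beta).+1)
     (if (x + k%:R) / beta < 1 then g ((x + k%:R) / beta) else 0).
  move=> Cx; rewrite -gT//; have [/andP[x0 x1] _] := Cx.
  rewrite (transferE beta_gt1) ?x0 ?ltW//; congr (_ * _).
  apply: eq_bigr => k _; rewrite /branch x1/=.
  have -> : (x + k%:R <= beta) = ((x + k%:R) / beta <= 1).
    by rewrite ler_pdivrMr// mul1r.
  rewrite le_eqVlt; case: eqVneq => //= e.
  by have := C_branch x k Cx; rewrite e => /(_ E1).
have g0 x : C x -> g x = 0.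
  apply: (branch_contraction beta_gt1 lambda_gt C01 _ g_transfer) => //.
  - move=> y k Cy yk1; split; last exact: C_branch.
    case: Cy => /andP[y0 _] _.
    by rewrite yk1 andbT divr_ge0 ?addr_ge0 ?(ltW beta_gt0).
  - move=> e d e0 d1.
    have e1 : 0 < e / (1 + normc c) by rewrite divr_gt0// ltr_pwDl ?normc_ge0.
    have [d' d'1 hd'] := parry1_near1 beta_gt1 lambda_gt e1.
    have md1 : Num.max d d' < 1 by rewrite gt_max d1.
    have [p [+ Cp pc]] := hc _ _ e1 md1; rewrite gt_max => /andP[dp d'p].
    exists p; split=> //; have [/andP[_ p1] _] := Cp.
    rewrite gE (_ : f p - c * h p = (f p - c) - c * (h p - 1)); last by ring.
    apply: le_lt_trans (le_normcD _ _) _; rewrite normcN normcM.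
    have := hd' p; rewrite d'p p1 => /(_ isT) hp.
    rewrite (_ : e = e / (1 + normc c) + normc c * (e / (1 + normc c))).
      by rewrite ltr_leD// ler_wpM2l ?normc_ge0 ?ltW.
    by field; rewrite gt_eqF// ltr_pwDl ?normc_ge0.
  - exact: bounded_cvariation_lin.
have c_neq0 : c != 0.
  apply: contra f_neq0 => /eqP c0; rewrite -BV_class0; apply/eqP.
  apply/BV_class_eqP/asboolP; exists E => // x /andP[x0 x1] nEx.
  rewrite [LHS](_ : _ = f x); last by rewrite -[RHS]subr0.
  rewrite -(g0 x) ?gE ?c0 ?mul0r ?subr0//; split=> //.
  rewrite x0 lt_neqAle x1 andbT; apply/eqP => x1'; apply: nEx.
  by rewrite x1'.
have [x _ Cx] := Cacc 0 ltr01.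
have := g_transfer x Cx.
rewrite g0// mulr0 add0r big1_seq => [|k _]; last first.
  case: ifP => // k1; apply: g0; split; last exact: C_branch.
  case: Cx => /andP[x0 _] _.
  by rewrite k1 andbT divr_ge0 ?addr_ge0 ?(ltW beta_gt0).
rewrite mulr0 => /eqP; rewrite oppr_eq0 !mulf_eq0 (negbTE c_neq0).
by rewrite (negbTE (lambda_neq0 beta_gt1 lambda_gt)) /= subr_eq0 => /eqP.
Qed.

End eigenvalue.

Theorem theorem4p3 (R : realType) (beta : R) (beta_gt1 : 1 < beta)
    (lambda : R[i]) (hlambda : (beta^-1)%:C < `|lambda| <= 1) :
  [/\ (forall x : R, 0 <= x < 1 -> right_continuous_at (F beta lambda) x),
      (forall x : R, 0 < x <= 1 -> ~ simple_number beta x ->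
         left_continuous_at (F beta lambda) x),
      (forall x : R, 0 < x <= 1 -> simple_number beta x ->
         (left_continuous_at (F beta lambda) x <->
          isolated_eigenvalue beta_gt1 lambda)),
      (lambda = 1 ->
         (forall x : R, 0 <= x <= 1 -> F beta lambda x = x%:C) /\
         (forall x : R, 0 <= x <= 1 ->
            differentiable_at01 (F beta lambda) x)) &
      (nonleading_eigenvalue beta_gt1 lambda ->
         ~ lipschitz01 (F beta lambda) /\
         (forall x : R, 0 <= x <= 1 ->
            ~ differentiable_at01 (F beta lambda) x))].
Proof.
move: hlambda; rewrite normr_normc ltcR -[1]/(1%:C) lecR => /andP[lgt lle1].
split.
- by move=> x; exact: F_right_continuous.
- by move=> x x01 ns; apply/left_continuousE => //; exact: F_left_nonsimple.
- move=> x x01 s; rewrite left_continuous_simple//.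
  by split; [exact: eigenvalue_of_F1|exact: F1_of_eigenvalue].
- move=> l1; have F1 x := F_id beta_gt1 lgt (x := x) l1; split=> // x x01.
  exists 1; apply/cvg_normcP => e e0.
  rewrite near_withinE /dnbhs near_withinE; apply: nearW => y yx y01.
  rewrite !F1// -rmorphB mulVf ?subrr ?normc0//.
  by rewrite -normc_eq0 normc_real normr_eq0 subr_eq0.
- move=> [/(F1_of_eigenvalue lgt) F1 l_neq1].
  have {lle1} l1 : normc lambda < 1.
    rewrite lt_neqAle lle1 andbT; apply: contra l_neq1 => /eqP l1.
    by apply/eqP; exact: (unimodular_eq1 beta_gt1 lgt).
  split; first exact: F_not_lipschitz.
  by move=> x; exact: F_not_differentiable.
Qed.
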